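(* Let $\Gamma$ be a connected amply regular graph with diameter $d=4$ and parameters $(v,k,\lambda,\mu)$, where $\mu=\frac{k-1}{2}$ and $k\ge5$ is odd. Then either $\Gamma\cong \mathrm{K}_2\,\square\,\Delta_{4.1}$, or $\Gamma$ is bipartite and, for a vertex $x$, admits an equitable partition $D_0=\{x\}$, $D_1=\Gamma(x)$, $D_2=\Gamma_2(x)$, $D_3$, $D_3'$ (with $D_3\cup D_3'=\Gamma_3(x)$), $D_4=\Gamma_4(x)$ of sizes $1,k,2k,k,2,1$ with quotient numbers (number of neighbours of a vertex of the first cell in the second cell, all others $0$): $D_0\to D_1: k$; $D_1\to D_0: 1$, $D_1\to D_2: k-1$; $D_2\to D_1: \frac{k-1}{2}$, $D_2\to D_3: \frac{k-1}{2}$, $D_2\to D_3': 1$; $D_3\to D_2: k-1$, $D_3\to D_4: 1$; $D_3'\to D_2: k$; $D_4\to D_3: k$.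
   Context: An amply regular graph with parameters $(v,k,\lambda,\mu)$ is a $k$-regular graph on $v$ vertices in which adjacent vertices have exactly $\lambda$ common neighbours and vertices at distance $2$ have exactly $\mu$ common neighbours. $\Gamma_i(x)$ is the set of vertices at distance $i$ from $x$. $\square$ is the Cartesian product, $\mathrm{K}_2$ a single edge, and $\Delta_{4.1}$ the point-block incidence graph of the square $2$-$(7,4,2)$ design. A partition is equitable if each vertex of cell $B_i$ has the same number $q_{ij}$ of neighbours in cell $B_j$. In the paper the partition is given by a figure; it is written out here explicitly. *)

(* Defs.v *)
From mathcomp Require Import all_boot.
Set Implicit Arguments. Unset Strict Implicit. Unset Printing Implicit Defensive.

Section Graphs.
Variable T : finType.
Implicit Types (e : rel T) (x y : T).

Definition simple_graph e := symmetric e /\ irreflexive e.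

Definition nbhd e x : {set T} := [set y | e x y].

Fixpoint ball e (n : nat) x : {set T} :=
  match n with
  | 0 => [set x]
  | n'.+1 => ball e n' x :|: \bigcup_(y in ball e n' x) nbhd e y
  end.

Definition sphere e (i : nat) x : {set T} :=
  match i with
  | 0 => [set x]
  | i'.+1 => ball e i x :\: ball e i' x
  end.

Definition connected_graph e := forall x y, connect e x y.

Definition diameter_eq e (d : nat) :=
  (forall x, ball e d x = setT) /\ (exists x y, y \in sphere e d x).

Definition common_nbrs e x y := #|nbhd e x :&: nbhd e y|.

Definition amply_regular e (v k lam mu : nat) :=
  [/\ #|T| = v,
      forall x, #|nbhd e x| = k,
      forall x y, e x y -> common_nbrs e x y = lam &
      forall x y, y \in sphere e 2 x -> common_nbrs e x y = mu].

Definition bipartite e := exists c : T -> bool, forall x y, e x y -> c x != c y.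

Definition nbrs_in e y (A : {set T}) := #|[set z in A | e y z]|.

Definition equitable_with e n (P : 'I_n -> {set T}) (q : 'I_n -> 'I_n -> nat) :=
  forall i j y, y \in P i -> nbrs_in e y (P j) = q i j.

End Graphs.

Definition isomorphic (T1 T2 : finType) (e1 : rel T1) (e2 : rel T2) :=
  exists f : T1 -> T2, bijective f /\ forall x y, e2 (f x) (f y) = e1 x y.

Definition cart_prod (T1 T2 : finType) (e1 : rel T1) (e2 : rel T2) : rel (T1 * T2) :=
  fun a b => ((a.1 == b.1) && e2 a.2 b.2) || (e1 a.1 b.1 && (a.2 == b.2)).

Definition K2 : rel bool := fun a b => a != b.

(* The square 2-(7,4,2) design: the complement of the Fano plane.  Points 'I_7,
   blocks 'I_7; Fano line j = {j, j+1, j+3} (mod 7), block j is its complement,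
   so point p lies in block j iff (p - j) mod 7 is in {2,4,5,6}. *)
Definition incid (p j : 'I_7) : bool := ((p + 7 - j) %% 7) \in [:: 2; 4; 5; 6].

Definition Delta41 : rel ('I_7 + 'I_7) := fun a b =>
  match a, b with
  | inl p, inr j => incid p j
  | inr j, inl p => incid p j
  | _, _ => false
  end.

Definition thm_cells (T : finType) (e : rel T) (x : T) (D3 D3' : {set T}) (i : 'I_6) : {set T} :=
  match val i with
  | 0 => [set x]
  | 1 => sphere e 1 x
  | 2 => sphere e 2 x
  | 3 => D3
  | 4 => D3'
  | _ => sphere e 4 x
  end.

Definition thm_quot (k : nat) (i j : 'I_6) : nat :=
  match val i, val j with
  | 0, 1 => k
  | 1, 0 => 1
  | 1, 2 => k - 1
  | 2, 1 => (k - 1) %/ 2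
  | 2, 3 => (k - 1) %/ 2
  | 2, 4 => 1
  | 3, 2 => k - 1
  | 3, 5 => 1
  | 4, 2 => k
  | 5, 3 => k
  | _, _ => 0
  end.

(* Main.v *)
Require Import Defs.
From mathcomp Require Import all_boot zify.
Set Implicit Arguments. Unset Strict Implicit. Unset Printing Implicit Defensive.

(** Let x, z be at distance 4.  A vertex m at distance 2 from both has mu neighbours next to x,
    mu next to z, and a single further neighbour; double counting around it forces lam = 0.
    A vertex b at distance 3 from x has c neighbours in the 2k-set Gamma_2(x), and the first two
    moments of the valencies from the rest of Gamma_2(x) leave c = k - 1, c = k, or mu = 2 and c = 3.
    When the last case does not interfere, Gamma_2(x) = Gamma_2(z), and the partition follows with
    D3 = Gamma(z).  Otherwise k = 5: Gamma_2(x) is the set of pairs from the five points of Gamma(x),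
    each neighbour of z at distance 3 from x is a triangle or a quadrangle on them, and each pair
    lies in 0 or 2 such faces.  The possible configurations are enumerated: a tetrahedron would give
    the 5-cube, of diameter 5, and a square pyramid determines all 28 vertices of K2 [] Delta41. *)

(** The diameter provides a single pair at distance 4, while the partition is wanted around every
    vertex. The bridge is a count: when Gamma_2(x) = Gamma_2(z), each neighbour of x again has a
    vertex at distance 4, so by connectedness every vertex has one. This needs the equality for all
    diametral pairs, hence a case split over all of them at once; one failing pair already
    determines the graph. Equality is reached by propagation: if a neighbour a of x has all its
    other neighbours in Gamma_2(z), then any other neighbour of x shares with a a second vertex,
    lying in Gamma_2(z), and the bound on c applies to it too. In the failing case mu = 2 and lam =
    0, so every common neighbour of two distinct vertices forces exactly one more. For the pyramid
    this yields the neighbours of all 28 listed vertices, but says little about coincidences between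
    entries far apart on the list. These are excluded by reading the list as a covering map, which
    is injective once the fibre over x is a single point. *)

(** * Enumeration of the face configurations on five points *)

Section FaceSearch.

(* The ten pairs of neighbours of x, in the order in which they index the entries of a row. *)
Definition pairs5 : seq (nat * nat) :=
  [:: (0, 1); (0, 2); (0, 3); (0, 4); (1, 2); (1, 3); (1, 4); (2, 3); (2, 4); (3, 4)].

Definition entry (r : seq bool) i j := nth false r (index (minn i j, maxn i j) pairs5).

Definition degree_ok r i := count (entry r i) (rem i (iota 0 5)) \in [:: 0; 2].

(** These are the graphs on five points with all degrees 0 or 2 and at most four edges: the empty
    graph, the triangles and the quadrangles. The bound 4 leaves room for [z] among the five
    neighbours and rules out pentagons. *)
Definition row_ok r := all (degree_ok r) (iota 0 5) && (count id r <= 4).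

Definition overlap r r' := count (fun c => nth false r c && nth false r' c) (iota 0 10).

Definition column M c := count (fun r => nth false r c) M.

Fixpoint bit_rows n : seq (seq bool) :=
  if n is n'.+1 then [seq b :: s | b <- [:: true; false], s <- bit_rows n'] else [:: [::]].

Definition rows := [seq r <- bit_rows 10 | row_ok r].

Definition relabel (s : seq nat) r := [seq entry r (nth 0 s q.1) (nth 0 s q.2) | q <- pairs5].

Definition row_of (qs : seq (nat * nat)) := [seq q \in qs | q <- pairs5].

Definition tetra_rows := [seq row_of qs | qs <-
  [:: [:: (1, 2); (1, 3); (2, 3)]; [:: (0, 2); (0, 3); (2, 3)];
      [:: (0, 1); (0, 3); (1, 3)]; [:: (0, 1); (0, 2); (1, 2)]; [::]]].

Definition pyramid_rows := [seq row_of qs | qs <-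
  [:: [:: (1, 2); (2, 3); (3, 4); (1, 4)]; [:: (0, 1); (0, 2); (1, 2)];
      [:: (0, 2); (0, 3); (2, 3)]; [:: (0, 3); (0, 4); (3, 4)]; [:: (0, 1); (0, 4); (1, 4)]]].

(* The conditionals, unlike [==>] and [||], keep [vm_compute] from evaluating pruned branches. *)
Definition classified M :=
  if all (fun c => column M c \in [:: 0; 2]) (iota 0 10) then
    if all (fun c => column M c != 0) (iota 0 10) then true
    else if all (fun c => column M c == 0) (iota 0 10) then true
    else has (fun s => let M' := [seq relabel s r | r <- M] in
           if perm_eq M' tetra_rows then true else perm_eq M' pyramid_rows) (permutations (iota 0 5))
  else true.

(** The order of the faces is irrelevant, so only nondecreasing index sequences are explored. An
    index may repeat, because the empty row may occur several times; a nonempty row overlaps itself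
    too much and is pruned. *)
Fixpoint search rs n lo M :=
  if n is n'.+1 then
    all (fun i => let r := nth [::] rs i in
      if all (fun r' => overlap r r' <= 1) M then search rs n' i (r :: M) else true)
      (iota lo (size rs - lo))
  else classified M.

Lemma search_sound rs n lo M (s : seq nat) :
  search rs n lo M -> size s = n -> path leq lo s -> all (gtn (size rs)) s ->
  pairwise (fun r r' => overlap r r' <= 1) (catrev [seq nth [::] rs i | i <- s] M) ->
  classified (catrev [seq nth [::] rs i | i <- s] M).
Proof.
elim: n lo M s => [|n IHn] lo M [|i s] //= srch [sz] /andP[lo_i path_s] /andP[i_lt s_lt] pw.
have /allP/(_ i) := srch; rewrite mem_iota lo_i /= subnKC ?(leq_trans lo_i (ltnW i_lt)) // => /(_ i_lt).
case: ifP => [_ /IHn|]; first exact.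
move: pw; rewrite catrevE pairwise_cat => /and3P[_ _ /=].
by move=> /andP[/allP ovl _] /allP; case; apply: ovl.
Qed.

Lemma search_rows : search rows 5 0 [::].
Proof. by vm_compute. Qed.

Lemma mem_bit_rows s : s \in bit_rows (size s).
Proof.
elim: s => [|b s IHs] //=; rewrite cats0 mem_cat.
by case: b; rewrite map_f // orbT.
Qed.

Lemma mem_rows r : size r = 10 -> row_ok r -> r \in rows.
Proof. by move=> sr r_ok; rewrite mem_filter r_ok -sr mem_bit_rows. Qed.

(** Serves to reorder the faces themselves, as vertices, once their rows are known to be a
    permutation of a target table. *)
Lemma perm_map_lift (A B : eqType) (g : A -> B) (l : seq A) t :
  perm_eq (map g l) t -> exists2 l', perm_eq l' l & map g l' = t.
Proof.
case: l => [|a0 l]; first by move=> /perm_size /esym/eqP; rewrite size_eq0 => /eqP->; exists [::].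
set l0 := a0 :: l; rewrite perm_sym => /(perm_iotaP (g a0))[Is pIs ->].
exists (map (nth a0 l0) Is).
  by apply/(perm_iotaP a0); exists Is; rewrite // -(size_map g).
rewrite -map_comp; apply/eq_in_map => i; rewrite (perm_mem pIs) mem_iota size_map => /andP[_ i_lt].
by rewrite [in RHS](nth_map a0).
Qed.

(** The last two hypotheses discard the outcomes that [classified] accepts without inspection: no
    zero column, and only zero columns. *)
Lemma classify_faces (B : eqType) (f : B -> seq bool) (bs : seq B) :
  size bs = 5 -> uniq bs -> {in bs, forall b, f b \in rows} ->
  {in bs &, forall b b', b != b' -> overlap (f b) (f b') <= 1} ->
  (forall c, c < 10 -> column (map f bs) c \in [:: 0; 2]) ->
  (exists2 c, c < 10 & column (map f bs) c != 0) ->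
  (exists2 c, c < 10 & column (map f bs) c == 0) ->
  exists s bs', [/\ perm_eq s (iota 0 5), perm_eq bs' bs &
    let M := [seq relabel s (f b) | b <- bs'] in M = tetra_rows \/ M = pyramid_rows].
Proof.
move=> bs5 bs_uniq f_rows f_ovl col02 col_ne0 col_0.
have := search_rows; move: rows f_rows => rs f_rows srch.
pose idx b := index (f b) rs.
(* Sorting by row index gives the nondecreasing sequence that [search] visits; columns and the final
   permutation do not see the order. *)
pose bs1 := sort (relpre idx leq) bs.
have p1 : perm_eq bs1 bs by rewrite perm_sort.
have mem1 := perm_mem p1.
have eqM : [seq nth [::] rs i | i <- map idx bs1] = map f bs1.
  rewrite -map_comp; apply/eq_in_map => b; rewrite mem1 => /f_rows bR.
  by rewrite /comp /idx nth_index.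
have colE c : column (rev (map f bs1)) c = column (map f bs) c.
  by rewrite /column count_rev; apply/permP; rewrite perm_map.
have srt : path leq 0 (map idx bs1).
  rewrite path_min_sorted; last by apply/allP.
  by rewrite sorted_map sort_sorted // => b b'; apply: leq_total.
have := search_sound srch (s := map idx bs1).
rewrite size_map size_sort bs5 eqM catrevE cats0 => /(_ erefl srt).
have -> : all (gtn (size rs)) (map idx bs1).
  by apply/allP=> _ /mapP[b + ->]; rewrite mem1 => /f_rows bR; rewrite /= /idx index_mem.
have -> : pairwise (fun r r' => overlap r r' <= 1) (rev (map f bs1)).
  rewrite -map_rev pairwise_map; have : uniq (rev bs1) by rewrite rev_uniq (perm_uniq p1).
  rewrite uniq_pairwise; apply: (sub_in_pairwise (P := mem bs)); first exact: f_ovl.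
  by apply/allP=> b; rewrite mem_rev mem1.
move=> /(_ isT isT); rewrite /classified.
have -> : all (fun c => column (rev (map f bs1)) c \in [:: 0; 2]) (iota 0 10).
  by apply/allP=> c; rewrite mem_iota colE => /andP[_ /col02].
rewrite ifF; last first.
  apply/allP=> H; have [c c_lt /eqP c0] := col_0.
  by have := H c; rewrite mem_iota colE c0 => /(_ c_lt).
rewrite ifF; last first.
  apply/allP=> H; have [c c_lt /eqP c0] := col_ne0.
  by have := H c; rewrite mem_iota colE => /(_ c_lt) /eqP.
case/hasP=> s; rewrite mem_permutations => ps H.
have [t pM tE] : exists2 t, perm_eq [seq relabel s r | r <- rev (map f bs1)] t &
    t = tetra_rows \/ t = pyramid_rows.
  by move: H => /=; case: ifP => [pM _|_ pM]; [exists tetra_rows|exists pyramid_rows] => //; [left|right].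
have [bs' pbs' eq_t] : exists2 bs', perm_eq bs' (rev bs1) & map (relabel s \o f) bs' = t.
  by apply: perm_map_lift; rewrite map_comp map_rev.
exists s, bs'; split => //; last by rewrite -eq_t in tE.
by rewrite (perm_trans pbs') // perm_rev.
Qed.

(* Entry i lists the neighbours of vertex i: 0 is x, then come its 5 neighbours, the 10 vertices of
   [pairs5], the 5 neighbours of z, z, the 4 remaining vertices at distance 3 from x, and the 2
   remaining ones at distance 4. *)
Definition pyramid_adj : seq (seq nat) :=
  [:: [:: 1; 2; 3; 4; 5]; [:: 0; 6; 7; 8; 9]; [:: 0; 6; 10; 11; 12]; [:: 0; 7; 10; 13; 14];
      [:: 0; 8; 11; 13; 15]; [:: 0; 9; 12; 14; 15]; [:: 1; 2; 17; 20; 22]; [:: 1; 3; 17; 18; 23];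
      [:: 1; 4; 18; 19; 22]; [:: 1; 5; 19; 20; 23]; [:: 2; 3; 16; 17; 24]; [:: 2; 4; 22; 24; 25];
      [:: 2; 5; 16; 20; 25]; [:: 3; 4; 16; 18; 25]; [:: 3; 5; 23; 24; 25]; [:: 4; 5; 16; 19; 24];
      [:: 10; 12; 13; 15; 21]; [:: 6; 7; 10; 21; 26]; [:: 7; 8; 13; 21; 27]; [:: 8; 9; 15; 21; 26];
      [:: 6; 9; 12; 21; 27]; [:: 16; 17; 18; 19; 20]; [:: 6; 8; 11; 26; 27]; [:: 7; 9; 14; 26; 27];
      [:: 10; 11; 14; 15; 26]; [:: 11; 12; 13; 14; 27]; [:: 17; 19; 22; 23; 24]; [:: 18; 20; 22; 23; 25]].

End FaceSearch.

(** * Graphs covered by a finite list of vertices with known neighbourhoods *)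

Section Covering.
Variables (T : finType) (e : rel T) (y0 : T) (vs : seq T) (adj : seq (seq nat)).
Hypotheses (e_sym : symmetric e) (conn : connected_graph e).
Local Notation g i := (nth y0 vs i).
Local Notation A i := (nth [::] adj i).
Hypothesis vs_gt0 : 0 < size vs.
Hypothesis adj_sym : forall i j, i < size vs -> j \in A i -> (j < size vs) && (i \in A j).
Hypothesis adj_desc : forall i, 0 < i < size vs -> has (fun j => j < i) (A i).
Hypothesis nbr_uniq : forall i, i < size vs -> uniq [seq g j | j <- A i].
Hypothesis nbrE : forall i, i < size vs -> forall y, e (g i) y = (y \in [seq g j | j <- A i]).
Hypothesis fibre0 : forall i, i < size vs -> g i = g 0 -> i = 0.

(* A covering map with a one-point fibre is injective: the fibre over [g i] lifts along the
   edge to an earlier vertex. *)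
Lemma cover_inj i q : i < size vs -> q < size vs -> g i = g q -> i = q.
Proof.
elim/ltn_ind: i q => -[|i] IHi q i_lt q_lt giq; first by rewrite (fibre0 q_lt).
have /hasP[j jAi j_lt] := adj_desc (i := i.+1) i_lt.
have /andP[j_lt' iAj] := adj_sym i_lt jAi.
have : g j \in [seq g j' | j' <- A q] by rewrite -nbrE // -giq nbrE // map_f.
case/mapP=> j' j'Aq gj; have /andP[j'_lt qAj'] := adj_sym q_lt j'Aq.
have jj' := IHi j j_lt j' j_lt' j'_lt gj; rewrite -{}jj' in qAj'.
have := nbr_uniq j_lt' => /(uniqP y0); rewrite size_map => U.
have iqA : index i.+1 (A j) = index q (A j).
  by apply: U; rewrite ?inE ?size_map ?index_mem // !(nth_map 0) ?index_mem // !nth_index.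
by rewrite -(nth_index 0 iAj) iqA nth_index.
Qed.

(** The listed vertices are closed under adjacency, so a path starting at [g 0] never leaves the
    list. *)
Lemma cover_surj y : exists2 i, i < size vs & y = g i.
Proof.
have [p] := connectP (conn (g 0) y).
suff lift i : i < size vs -> path e (g i) p -> y = last (g i) p ->
    exists2 i, i < size vs & y = g i by exact: lift.
elim: p i => [|t p IHp] i i_lt /=; first by move=> _ ->; exists i.
case/andP; rewrite nbrE // => /mapP[j jA ->].
by have /andP[j_lt _] := adj_sym i_lt jA; apply: IHp j_lt.
Qed.

Lemma cover_adj i j : i < size vs -> j < size vs -> e (g i) (g j) = (j \in A i).
Proof.
move=> i_lt j_lt; rewrite nbrE //; apply/mapP/idP=> [[j' j'A gj]|jA]; last by exists j.
have /andP[j'_lt _] := adj_sym i_lt j'A.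
by rewrite (cover_inj j_lt j'_lt gj).
Qed.

End Covering.

(** * The list [pyramid_adj] presents K2 [] Delta41 *)

Section PyramidGraph.

(** Replaces ordinals by plain numbers, so that the adjacency checks over all pairs of vertices are
    pure computations. *)
Definition vertex_code (a : bool * ('I_7 + 'I_7)) : bool * bool * nat :=
  match a.2 with inl p => (a.1, false, val p) | inr j => (a.1, true, val j) end.

Definition incid_nat p j := ((p + 7 - j) %% 7) \in [:: 2; 4; 5; 6].

Definition cart_nat (a a' : bool * bool * nat) :=
  let: (c, s, p) := a in let: (c', s', p') := a' in
  (c == c') && (if s then (if s' then false else incid_nat p' p)
                else if s' then incid_nat p p' else false)
  || (c != c') && ((s == s') && (p == p')).

Lemma cart_natE a a' : cart_prod K2 Delta41 a a' = cart_nat (vertex_code a) (vertex_code a').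
Proof. by case: a a' => c [p|p] [c' [p'|p']]. Qed.

(* An isomorphism from K2 [] Delta41 onto the graph [pyramid_adj], found by backtracking. *)
Definition pyramid_label : seq nat :=
  [:: 0; 13; 15; 12; 14; 11; 10; 24; 2; 3; 4; 16; 5; 25;
      1; 18; 19; 20; 23; 22; 17; 26; 6; 7; 8; 21; 9; 27].

Definition label_of (a : bool * bool * nat) :=
  let: (c, s, p) := a in nth 0 pyramid_label (14 * c + 7 * s + p).

Definition codes := [seq (cs, p) | cs <- [seq (c, s) | c <- [:: true; false], s <- [:: true; false]],
                                   p <- iota 0 7].

Lemma vertex_code_mem a : vertex_code a \in codes.
Proof.
by case: a => c [] p; apply/allpairsP; [exists (c, false, val p) | exists (c, true, val p)];
  split; rewrite ?mem_iota ?ltn_ord //=; case: c.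
Qed.

Lemma vertex_code_inj : injective vertex_code.
Proof. by move=> [c [p|p]] [c' [p'|p']] [] // -> /val_inj->. Qed.

Lemma label_lt a : a \in codes -> label_of a < 28.
Proof. by move: a; apply/allP. Qed.

Lemma label_inj : {in codes &, injective label_of}.
Proof.
have : all (fun a => all (fun a' => (label_of a == label_of a') ==> (a == a')) codes) codes.
  by vm_compute.
by move/allP=> H a a' /H/allP H' /H'/implyP imp /eqP/imp/eqP.
Qed.

Lemma label_adj : {in codes &, forall a a',
  (label_of a' \in nth [::] pyramid_adj (label_of a)) = cart_nat a a'}.
Proof.
have : all (fun a => all (fun a' =>
    (label_of a' \in nth [::] pyramid_adj (label_of a)) == cart_nat a a') codes) codes.
  by vm_compute.
by move/allP=> H a a' /H/allP H' /H'/eqP.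
Qed.

Lemma pyramid_iso (T : finType) (e : rel T) (y0 : T) (vs : seq T) :
  symmetric e -> connected_graph e -> size vs = 28 -> nth y0 vs 0 = y0 ->
  (forall i, i < 28 -> nth y0 vs i = y0 -> i = 0) ->
  (forall i, i < 28 -> let s := [seq nth y0 vs j | j <- nth [::] pyramid_adj i] in
     uniq s /\ forall y, e (nth y0 vs i) y = (y \in s)) ->
  isomorphic e (cart_prod K2 Delta41).
Proof.
move=> e_sym conn vs28 vs0 fib loc.
have adj_sym i j : i < size vs -> j \in nth [::] pyramid_adj i ->
    (j < size vs) && (i \in nth [::] pyramid_adj j).
  rewrite vs28 => i28.
  have /allP/(_ i) : all (fun i => all (fun j => (j < 28) && (i \in nth [::] pyramid_adj j))
     (nth [::] pyramid_adj i)) (iota 0 28) by vm_compute.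
  by rewrite mem_iota => /(_ i28)/allP; apply.
have adj_desc i : 0 < i < size vs -> has (fun j => j < i) (nth [::] pyramid_adj i).
  rewrite vs28 => i28.
  have /allP : all (fun i => has (fun j => j < i) (nth [::] pyramid_adj i)) (iota 1 27) by [].
  by apply; rewrite mem_iota.
have vs_gt0 : 0 < size vs by rewrite vs28.
have nu i : i < size vs -> uniq [seq nth y0 vs j | j <- nth [::] pyramid_adj i].
  by rewrite vs28 => /loc[].
have nE i : i < size vs -> forall y, e (nth y0 vs i) y = (y \in [seq nth y0 vs j | j <- nth [::] pyramid_adj i]).
  by rewrite vs28 => /loc[].
have fib0 i : i < size vs -> nth y0 vs i = nth y0 vs 0 -> i = 0 by rewrite vs28 vs0; apply: fib.
have inj := cover_inj adj_sym adj_desc nu nE fib0.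
have surj := cover_surj conn vs_gt0 adj_sym nE.
have adjE := cover_adj adj_sym adj_desc nu nE fib0.
rewrite vs28 in inj surj adjE.
(* The map is built from the product to the graph; it is injective, and the list bounds the order of
   the graph by 28 = 2 * (7 + 7), so it is bijective and its inverse is the isomorphism. *)
pose h a := nth y0 vs (label_of (vertex_code a)).
have h_lt a := label_lt (vertex_code_mem a).
have h_inj : injective h.
  move=> a a' /inj eqh; apply: vertex_code_inj; apply: label_inj; rewrite ?vertex_code_mem //.
  exact: eqh.
have [f hK fK] : bijective h.
  apply: inj_card_bij => //; rewrite card_prod card_sum card_bool card_ord -[2 * (7 + 7)]vs28.
  apply: leq_trans (card_size vs); apply/subset_leq_card/subsetP=> y _.
  by have [i i28 ->] := surj y; rewrite mem_nth ?vs28.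
exists f; split; first by exists h.
move=> y t; rewrite cart_natE -label_adj ?vertex_code_mem // -adjE ?h_lt //.
by rewrite -/(h _) -/(h _) !fK.
Qed.

End PyramidGraph.

Local Arguments sphere : simpl never.

(** * Distances and double counting *)

Section AmplyRegular.
Variables (T : finType) (e : rel T).
Hypotheses (e_sym : symmetric e) (e_irr : irreflexive e).
Hypothesis diam4 : forall x, ball e 4 x = setT.

Lemma in_nbhd x y : (y \in nbhd e x) = e x y.
Proof. by rewrite inE. Qed.

Lemma ballS n x y :
  reflect (y \in ball e n x \/ exists2 z, z \in ball e n x & e z y)
          (y \in ball e n.+1 x).
Proof.
rewrite /= inE; apply: (iffP orP) => -[yb|].
- by left.
- by case/bigcupP=> z zb; rewrite in_nbhd => ezy; right; exists z.
- by left.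
- by case=> z zb ezy; right; apply/bigcupP; exists z => //; rewrite in_nbhd.
Qed.

Lemma ball_mono m n x : m <= n -> ball e m x \subset ball e n x.
Proof.
elim: n => [|n IHn]; first by rewrite leqn0 => /eqP->.
rewrite leq_eqVlt => /orP[/eqP->//|]; rewrite ltnS => /IHn sub.
by apply: subset_trans sub _; rewrite /= subsetUl.
Qed.

Lemma ball_cons n x y z : e x y -> z \in ball e n y -> z \in ball e n.+1 x.
Proof.
move=> exy; elim: n z => [|n IHn] z.
  rewrite inE => /eqP->; apply/ballS; right; exists x => //; exact: set11.
case/ballS=> [/IHn zb|[t /IHn tb etz]]; apply/ballS; first by left.
by right; exists t.
Qed.

Lemma ball_sym n x y : (y \in ball e n x) = (x \in ball e n y).
Proof.
suff imp a b : b \in ball e n a -> a \in ball e n b by apply/idP/idP; apply: imp.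
elim: n a b => [|n IHn] a b; first by rewrite !inE eq_sym.
case/ballS=> [/IHn ab|[t /IHn tb etb]]; first by apply/ballS; left.
by apply: ball_cons tb; rewrite e_sym.
Qed.

Lemma ball_ex x y : exists n, y \in ball e n x.
Proof. by exists 4; rewrite diam4 inE. Qed.

Definition dist x y := ex_minn (ball_ex x y).

Lemma dist_le n x y : (dist x y <= n) = (y \in ball e n x).
Proof.
rewrite /dist; case: ex_minnP => m ym minm; apply/idP/idP => [/(ball_mono x) /subsetP|/minm//].
exact.
Qed.

Lemma in_sphere i x y : (y \in sphere e i x) = (dist x y == i).
Proof.
case: i => [|i]; first by rewrite -leqn0 dist_le.
by rewrite /sphere in_setD -!dist_le -ltnNge eqn_leq andbC.
Qed.

Lemma dist_sym x y : dist x y = dist y x.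
Proof. by apply/eqP; rewrite eqn_leq !dist_le ball_sym -dist_le leqnn ball_sym -dist_le leqnn. Qed.

Lemma dist0 x y : (dist x y == 0) = (x == y).
Proof. by rewrite -in_sphere inE eq_sym. Qed.

Lemma distxx x : dist x x = 0.
Proof. by apply/eqP; rewrite dist0. Qed.

Lemma dist_edge x y z : e y z -> dist x z <= (dist x y).+1.
Proof.
move=> eyz; rewrite dist_le; apply/ballS; right; exists y => //.
by rewrite -dist_le.
Qed.

Lemma dist_edge2 x y z : e y z -> (dist x z <= (dist x y).+1) && (dist x y <= (dist x z).+1).
Proof. by move=> eyz; rewrite !dist_edge // e_sym. Qed.

Lemma dist_pred n x y : dist x y = n.+1 -> exists2 z, dist x z = n & e z y.
Proof.
move=> dxy; have : y \in ball e n.+1 x by rewrite -dist_le dxy.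
case/ballS=> [|[z]]; first by rewrite -dist_le dxy ltnn.
rewrite -dist_le => zn ezy; exists z => //.
by have := dist_edge x ezy; lia.
Qed.

Lemma dist1 x y : (dist x y == 1) = e x y.
Proof.
apply/eqP/idP=> [/dist_pred[z /eqP]|exy]; first by rewrite dist0 => /eqP->.
have := dist_edge x exy; rewrite distxx; case: (dist x y =P 0) => [/eqP|]; last by lia.
by rewrite dist0 => /eqP xy; rewrite xy e_irr in exy.
Qed.

Lemma dist_le4 x y : dist x y <= 4.
Proof. by rewrite dist_le diam4 inE. Qed.

Lemma dist_path2 x y z : e x y -> e y z -> dist x z <= 2.
Proof. by move=> exy /(dist_edge x); move: exy; rewrite -dist1 => /eqP->. Qed.

Lemma sum_nbhd (A B : {set T}) :
  \sum_(a in A) #|nbhd e a :&: B| = \sum_(b in B) #|nbhd e b :&: A|.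
Proof.
transitivity (\sum_(a in A) \sum_(b in B) (e a b : nat)).
  apply: eq_bigr => a _; rewrite -sum1_card [LHS]big_mkcond [RHS]big_mkcond /=.
  by apply: eq_bigr => b _; rewrite !inE; case: (e a b); case: (b \in B).
rewrite exchange_big; apply: eq_bigr => b _.
rewrite -sum1_card [LHS]big_mkcond [RHS]big_mkcond /=; apply: eq_bigr => a _.
by rewrite !inE e_sym; case: (e b a); case: (a \in A).
Qed.

Lemma sum_const_on (A : {set T}) (F : T -> nat) c :
  (forall a, a \in A -> F a = c) -> \sum_(a in A) F a = #|A| * c.
Proof. by move=> Fc; rewrite (eq_bigr (fun=> c)) // sum_nat_const. Qed.

Local Notation N := (nbhd e).
Local Notation d := dist.
Local Notation memE := (in_nbhd, in_sphere, in_setI, in_setU, in_setD1, in_setD, in_set1, in_set0).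
Variables (lam mu : nat).
Hypothesis mu_gt1 : 1 < mu.
Hypothesis lamE : forall x y, e x y -> #|N x :&: N y| = lam.
Hypothesis muE : forall x y, d x y = 2 -> #|N x :&: N y| = mu.

(** The path [x], [y], [m], [b] has length 3 between vertices at distance 3, so it is a geodesic. *)
Lemma dist2_mid x b m y : d x b = 3 -> e b m -> e x y -> e m y -> d x m = 2 /\ d b y = 2.
Proof.
move=> dxb ebm exy emy.
have := dist_path2 exy; have := dist_path2 ebm emy.
move=> b1 /(_ m); rewrite e_sym emy => /(_ isT) b2.
have := dist_edge2 x ebm; have := dist_edge2 b exy.
rewrite (dist_sym b x) dxb; lia.
Qed.

(** The two sets span a bipartite graph in which every vertex, on either side, has degree [mu]: all
    common neighbours with the opposite end lie in the other set. *)
Lemma card_mid3 x b : d x b = 3 -> #|N b :&: sphere e 2 x| = #|N x :&: sphere e 2 b|.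
Proof.
move=> dxb.
have dbx : d b x = 3 by rewrite dist_sym.
have H u v m : d u v = 3 -> m \in N v :&: sphere e 2 u -> #|N m :&: (N u :&: sphere e 2 v)| = mu.
  move=> duv; rewrite !memE => /andP[evm /eqP dum].
  rewrite -(muE (x := m) (y := u)) ?(dist_sym m) //; apply: eq_card => y; rewrite !memE.
  case: (boolP (e m y)) => //= emy; case: (boolP (e u y)) => //= euy.
  by have [_ ->] := dist2_mid duv evm euy emy.
have := sum_nbhd (N b :&: sphere e 2 x) (N x :&: sphere e 2 b).
rewrite (sum_const_on (fun m => H x b m dxb)) (sum_const_on (fun m => H b x m dbx)).
by move/eqP; rewrite eqn_pmul2r ?(ltnW mu_gt1) // => /eqP.
Qed.

(** * Pairs of vertices at distance 4 *)

Section Diametral.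
Variables x z : T.
Hypothesis dxz : d x z = 4.

Lemma diametral_mid_ex : exists m, d x m = 2 /\ d m z = 2.
Proof.
have [b db ebz] := dist_pred dxz; have [m dm emb] := dist_pred db.
exists m; split=> //; have := dist_path2 emb ebz.
have := dist_edge2 m ebz.
have [a da eam] := dist_pred dm; have [t dt eta] := dist_pred da.
move: dt => /eqP; rewrite dist0 => /eqP xt; subst t.
have e1 : d z x <= (d z a).+1 by apply: dist_edge; rewrite // e_sym.
have e2 : d z a <= (d z m).+1 by apply: dist_edge; rewrite // e_sym.
by move: e1 e2; rewrite !(dist_sym z) dxz; lia.
Qed.

Lemma diametral_nbr_disj m : N m :&: N x :&: N z = set0.
Proof.
apply/setP=> y; rewrite !memE; apply/negP=> /andP[/andP[_ exy] ezy].
by have := dist_path2 exy (_ : e y z); rewrite dxz e_sym => /(_ ezy).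
Qed.

Lemma diametral_nbr_edge a b : e x a -> e z b -> e a b = false.
Proof.
move=> exa ezb; apply/negP=> eab.
have := dist_path2 exa eab; have := dist_edge x (_ : e b z).
by rewrite dxz e_sym => /(_ ezb); lia.
Qed.

Lemma diametral_nbr3 a m : e x a -> e a m -> d m z = 2 -> d a z = 3 /\ d x m = 2.
Proof.
move=> exa eam dmz.
have le2 := dist_path2 exa eam.
have := dist_edge2 z exa; have := dist_edge2 z eam.
rewrite !(dist_sym z) dxz dmz => z1 z2; split; first by lia.
have := dist0 x m; have := dist1 x m; case: (x =P m) dmz => [<-|_ dmz]; first by rewrite dxz.
case: (boolP (e x m)) => [/(dist_edge2 z)|_]; last by lia.
by rewrite !(dist_sym z) dxz dmz.
Qed.

End Diametral.

Hypothesis regE : forall x, #|N x| = mu.*2.+1.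

(** This is where k = 2 mu + 1 acts: the [mu] common neighbours with [x] and the [mu] with [z] are
    disjoint. *)
Lemma rest_card x z m : d x z = 4 -> d x m = 2 -> d m z = 2 -> #|N m :\: (N x :|: N z)| = 1.
Proof.
move=> dxz dxm dmz.
have := cardsID (N x :|: N z) (N m); rewrite setIUr cardsU.
have -> : N m :&: N x :&: (N m :&: N z) = N m :&: N x :&: N z.
  by apply/setP=> y; rewrite !memE; case: (e m y).
rewrite diametral_nbr_disj // cards0 regE (muE dmz) (muE (x := m) (y := x)); first by lia.
by rewrite dist_sym.
Qed.

(** * Adjacent vertices have no common neighbour *)

Section Triangles.
Hypothesis lam_gt0 : 0 < lam.

(* [a] has at least [mu] neighbours at distance 2 from [z]; counting the edges from them to the
   [lam] common neighbours of [a] and [x] is only possible if [a] sees the exceptional [w]. *)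
Lemma rest_adj x z m a w : d x z = 4 -> d m z = 2 -> e x a -> e a m ->
  w \in N m :\: (N x :|: N z) -> lam <= mu /\ e a w.
Proof.
move=> dxz dmz exa eam wm.
have [daz dxm] := diametral_nbr3 dxz exa eam dmz.
have loc m' : m' \in N a :&: sphere e 2 z ->
    lam <= #|N m' :&: (N a :&: N x)| + #|N a :&: (N m' :\: (N x :|: N z))| /\
    #|N m' :\: (N x :|: N z)| = 1.
  rewrite !memE dist_sym => /andP[eam' /eqP dm'].
  have [_ dxm'] := diametral_nbr3 dxz exa eam' dm'.
  split; last exact: rest_card.
  rewrite -(lamE eam') -cardsUI; apply: leq_trans (leq_addr _ _).
  apply/subset_leq_card/subsetP=> y; rewrite !memE => /andP[eay emy]; rewrite eay emy /=.
  case exy: (e x y) => //=; rewrite andbT; apply/negP=> ezy.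
  by rewrite (diametral_nbr_edge dxz exa ezy) in eay.
have loc1 m' : m' \in N a :&: sphere e 2 z -> lam - 1 <= #|N m' :&: (N a :&: N x)|.
  move=> /loc[l1 l2].
  have : #|N a :&: (N m' :\: (N x :|: N z))| <= 1 by rewrite -l2 subset_leq_card // subsetIr.
  by lia.
have mM : m \in N a :&: sphere e 2 z by rewrite !memE eam dist_sym dmz.
have lam_mu : lam <= mu.
  have : #|N m :&: (N a :&: N x)| <= mu - 1.
    rewrite -(muE dxm) (cardsD1 a (N x :&: N m)) !memE exa e_sym eam /= subn1 /=.
    apply/subset_leq_card/subsetP=> y; rewrite !memE => /and3P[emy eay exy].
    by rewrite emy exy andbT andbT; apply: contraTneq eay => ->; rewrite e_irr.
  by have := loc1 m mM; lia.
split=> //; apply: contraT => naw.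
have lam_m : lam <= #|N m :&: (N a :&: N x)|.
  have [l1 /eqP/cards1P[w' ww']] := loc m mM.
  have : N a :&: (N m :\: (N x :|: N z)) = set0.
    apply/setP=> y; rewrite in_set0 in_setI in_nbhd; case ym: (y \in N m :\: _); last by rewrite andbF.
    move: ym wm; rewrite ww' !memE => /eqP-> /eqP <-; by rewrite andbT (negbTE naw).
  by move=> H; move: l1; rewrite H cards0 addn0.
have Mge : mu <= #|N a :&: sphere e 2 z|.
  rewrite card_mid3; last by rewrite dist_sym.
  rewrite -(muE dmz); apply/subset_leq_card/subsetP=> y; rewrite !memE => /andP[emy ezy].
  rewrite ezy; apply/eqP.
  have dza : d z a = 3 by rewrite dist_sym.
  by have [_ ->] := dist2_mid dza eam ezy emy.
(* Counted from the other side: each of the [lam] common neighbours [p] of [a] and [x] has [lam]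
   common neighbours with [a], one of which is [x] itself and is not at distance 2 from [z]. *)
have S1 : \sum_(m' in N a :&: sphere e 2 z) #|N m' :&: (N a :&: N x)| <= lam * (lam - 1).
  rewrite (sum_nbhd).
  have cax : #|N a :&: N x| = lam by rewrite setIC lamE.
  rewrite -{1}cax.
  rewrite -sum_nat_const; apply: leq_sum => p; rewrite !memE => /andP[eap exp].
  have := lamE eap; rewrite (cardsD1 x) !memE !(e_sym _ x) exa exp /= => <-.
  rewrite addKn.
  apply/subset_leq_card/subsetP=> y; rewrite !memE => /and3P[-> -> /eqP dzy].
  rewrite andbT andbT; by apply/eqP=> yx; move: dzy; rewrite yx dist_sym dxz.
(* Every term is at least [lam - 1], and the term of [m] is at least [lam] because [a] is assumed
   not to see [w]. With at least [mu >= lam] terms this exceeds the bound [S1]. *)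
have S2 : #|N a :&: sphere e 2 z| * (lam - 1) + 1 <=
   \sum_(m' in N a :&: sphere e 2 z) #|N m' :&: (N a :&: N x)|.
  rewrite (bigD1 m) //= (cardsD1 m) mM mulnDl mul1n.
  have : \sum_(i in (N a :&: sphere e 2 z) :\ m) (lam - 1) <=
     \sum_(i in N a :&: sphere e 2 z | i != m) #|N i :&: (N a :&: N x)|.
    rewrite (eq_bigl (fun i => (i \in N a :&: sphere e 2 z) && (i != m))); last first.
      by move=> i; rewrite in_setD1 andbC.
    by apply: leq_sum => i /andP[/loc1].
  by rewrite sum_nat_const; lia.
by nia.
Qed.

(** The exceptional neighbour [w] of a midpoint [m] is adjacent to all [2 mu] neighbours of [m] next
    to [x] or [z]. They are common neighbours of the adjacent vertices [m] and [w], whereas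
    [lam <= mu]. *)
Lemma triangles_absurd x z : d x z != 4.
Proof.
apply/eqP=> dxz; have [m [dxm dmz]] := diametral_mid_ex dxz.
have /eqP/cards1P[w Ww] := rest_card dxz dxm dmz.
have wW : w \in N m :\: (N x :|: N z) by rewrite Ww set11.
have wW' : w \in N m :\: (N z :|: N x) by rewrite setUC.
have dzx : d z x = 4 by rewrite dist_sym.
have dmx : d m x = 2 by rewrite dist_sym.
have emw : e m w by move: wW; rewrite !memE => /andP[].
have lamu : lam <= mu.
  have : 0 < #|N x :&: N m| by rewrite muE //; lia.
  case/card_gt0P=> a; rewrite !memE => /andP[exa ema].
  by have [] // := rest_adj dxz dmz exa (_ : e a m) wW; rewrite e_sym.
have : mu.*2 <= lam; last by lia.
rewrite -(lamE emw); have := diametral_nbr_disj dxz m.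
move=> D0; have : #|(N m :&: N x) :|: (N m :&: N z)| = mu.*2.
  rewrite cardsU.
  have -> : N m :&: N x :&: (N m :&: N z) = N m :&: N x :&: N z.
    by apply/setP=> y; rewrite !memE; case: (e m y).
  by rewrite D0 cards0 (muE dmz) (muE dmx) subn0 addnn.
move=> <-; apply/subset_leq_card/subsetP=> y; rewrite -setIUr !memE => /andP[emy].
rewrite emy /= => /orP[] ey; rewrite e_sym in emy; rewrite e_sym.
  by have [_ ->] := rest_adj dxz dmz ey emy wW.
by have [_ ->] := rest_adj dzx dmx ey emy wW'.
Qed.

End Triangles.

Lemma triangle_free x z : d x z = 4 -> lam = 0.
Proof. by move=> dxz; case: (posnP lam) => // /triangles_absurd - /(_ x z); rewrite dxz. Qed.

(** * Moment bounds at distance 3 in the triangle-free case *)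

Hypothesis lam0 : lam = 0.

Lemma no_triangle x y z : e x y -> e y z -> e x z = false.
Proof.
move=> exy eyz; apply/negP=> exz; have := lamE exz; rewrite lam0 => /eqP.
by rewrite cards_eq0 => /eqP/setP/(_ y); rewrite !memE exy e_sym eyz.
Qed.

Lemma dist_two x y z : e x y -> e y z -> x != z -> d x z = 2.
Proof.
move=> exy eyz; have := dist_path2 exy eyz; rewrite -dist0.
by have := dist1 x z; rewrite (no_triangle exy eyz); lia.
Qed.

Lemma card_common x y z : e x y -> e y z -> x != z -> #|N x :&: N z| = mu.
Proof. by move=> exy eyz xz; apply: muE; apply: dist_two eyz xz. Qed.

Lemma nbhd_split x a : e x a -> N a :\ x = N a :&: sphere e 2 x.
Proof.
move=> exa; apply/setP=> y; rewrite !memE andbC.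
case: (boolP (e a y)) => //= eay; case: (y =P x) => [->|/eqP yx].
  by rewrite distxx.
by rewrite (dist_two exa eay) // eq_sym.
Qed.

Lemma card_nbhd_split x a : e x a -> #|N a :&: sphere e 2 x| = mu.*2.
Proof.
move=> exa; have := regE a; rewrite (cardsD1 x) memE e_sym exa nbhd_split //.
by move=> [].
Qed.

Lemma card_sphere2 x : #|sphere e 2 x| = mu.*2.+1.*2.
Proof.
have := sum_nbhd (N x) (sphere e 2 x).
rewrite (@sum_const_on _ _ mu.*2) => [|a]; last by rewrite memE; apply: card_nbhd_split.
rewrite (@sum_const_on _ _ mu) => [|a]; last by rewrite memE => /eqP dxa; apply: muE; rewrite dist_sym.
by rewrite regE; nia.
Qed.

(** A square counts ordered pairs of neighbours in [B], which are then summed the other way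
    round. *)
Lemma sum_sq_nbhd (A B : {set T}) :
  \sum_(i in A) #|N i :&: B| ^ 2 = \sum_(y in B) \sum_(y' in B) #|N y :&: N y' :&: A|.
Proof.
have cardE (C D : {set T}) : #|C :&: D| = \sum_(i in D) (i \in C : nat).
  rewrite -sum1_card [LHS]big_mkcond [RHS]big_mkcond; apply: eq_bigr => i _.
  by rewrite !inE; case: (i \in C); case: (i \in D).
transitivity (\sum_(i in A) \sum_(y in B) \sum_(y' in B) (i \in N y :&: N y' : nat)).
  apply: eq_bigr => i _; rewrite -mulnn {1}cardE big_distrl; apply: eq_bigr => y _ /=.
  rewrite cardE big_distrr; apply: eq_bigr => y' _ /=.
  by rewrite !memE !(e_sym _ i); case: (e i y); case: (e i y').
rewrite exchange_big; apply: eq_bigr => y _; rewrite exchange_big.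
by apply: eq_bigr => y' _; rewrite cardE.
Qed.

Lemma cauchy_sum (A : {set T}) (F : T -> nat) :
  (\sum_(i in A) F i) ^ 2 <= #|A| * \sum_(i in A) F i ^ 2.
Proof.
have S1 : \sum_(i in A) \sum_(j in A) (F i ^ 2 + F j ^ 2) = 2 * (#|A| * \sum_(i in A) F i ^ 2).
  under eq_bigr do rewrite big_split sum_nat_const /=.
  by rewrite big_split /= sum_nat_const -big_distrr /= mul2n addnn.
have S2 : \sum_(i in A) \sum_(j in A) (2 * (F i * F j)) = 2 * (\sum_(i in A) F i) ^ 2.
  rewrite -mulnn big_distrlr /= big_distrr; apply: eq_bigr => i _ /=.
  by rewrite big_distrr.
have : \sum_(i in A) \sum_(j in A) (2 * (F i * F j)) <= \sum_(i in A) \sum_(j in A) (F i ^ 2 + F j ^ 2).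
  by apply: leq_sum => i _; apply: leq_sum => j _; apply: nat_Cauchy.
by rewrite S1 S2; lia.
Qed.

(* With [O] the vertices of Gamma_2(x) not adjacent to [b] and [F i] the number of common
   neighbours of [i] and [x] lying in Gamma_2(b), the first two moments of [F] on [O] are known;
   they are compared through F <= F^2, (F-1)(F-2) >= 0 and Cauchy-Schwarz. *)
Lemma mid3_bound x b : d x b = 3 ->
  mu.*2 <= #|N b :&: sphere e 2 x| <= mu.*2.+1 \/ mu = 2 /\ #|N b :&: sphere e 2 x| = 3.
Proof.
move=> dxb; set c := #|_|.
have cle : c <= mu.*2.+1 by rewrite -(regE b) subset_leq_card // subsetIl.
pose Y := N x :&: sphere e 2 b; pose X := N b :&: sphere e 2 x.
have cY : #|Y| = c by rewrite /c card_mid3.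
have c_gt0 : 0 < c.
  have [m dm emb] := dist_pred dxb; rewrite /c (cardD1 m) !memE e_sym emb dm; lia.
pose F i := #|N i :&: Y|; pose O := sphere e 2 x :\: X.
have subX : X \subset sphere e 2 x by rewrite subsetIr.
have FX i : i \in X -> F i = mu.
  rewrite !memE => /andP[ebi /eqP dxi]; rewrite -(muE (x := i) (y := x)) ?(dist_sym i) //.
  apply: eq_card => y; rewrite !memE; case: (boolP (e i y)) => //= eiy.
  case: (boolP (e x y)) => //= exy; by have [_ ->] := dist2_mid dxb ebi exy eiy.
have cO : #|O| = mu.*2.+1.*2 - c by rewrite cardsD (setIidPr subX) card_sphere2.
have split_sum (G : T -> nat) :
    \sum_(i in sphere e 2 x) G i = \sum_(i in X) G i + \sum_(i in O) G i.
  by rewrite (big_setID X) /= (setIidPr subX).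
(* Over all of Gamma_2(x) the sum is [c * 2 mu]; the vertices of [X] account for [c * mu] of it. *)
have L : \sum_(i in O) F i = c * mu.
  have := split_sum F; rewrite (sum_const_on FX) -sum_nbhd.
  rewrite (@sum_const_on _ _ mu.*2) => [|a]; last first.
    by rewrite memE => /andP[+ _]; rewrite memE => /card_nbhd_split.
  by rewrite cY -/c -/X; lia.
(* For fixed [y] in [Y], the diagonal term is [2 mu]; each of the [c - 1] other [y'] shares [mu]
   vertices with [y], one of them being [x], which leaves [mu - 1]. *)
have Q : \sum_(i in O) F i ^ 2 + c * mu ^ 2 = c * (mu.*2 + (c - 1) * (mu - 1)).
  have := split_sum (fun i => F i ^ 2); rewrite (@sum_const_on X _ (mu ^ 2)); last by move=> i iX; rewrite FX.
  rewrite addnC => <-; rewrite sum_sq_nbhd -cY; apply: sum_const_on => y yY.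
  have exy : e x y by move: yY; rewrite !memE => /andP[].
  rewrite (big_setD1 y) //= setIid card_nbhd_split //; congr (_ + _).
  rewrite [#|Y|](cardsD1 y) yY addKn; apply: sum_const_on => y'.
  rewrite !memE => /and3P[yy' exy' _].
  have := card_common (x := y) (y := x) (z := y'); rewrite e_sym exy exy' eq_sym yy'.
  move=> /(_ isT isT isT); rewrite (cardsD1 x) !memE !(e_sym _ x) exy exy' => <-.
  rewrite addKn; apply: eq_card => t; rewrite !memE andbC.
  have := nbhd_split exy; move/setP/(_ t); rewrite !memE; case: (e y t) => /=; last by rewrite !andbF.
  by case: (e y' t) => /=; rewrite ?andbF ?andbT // => <-.
have I1 : \sum_(i in O) F i <= \sum_(i in O) F i ^ 2.
  by apply: leq_sum => i _; case: (F i) => // n; rewrite -mulnn leq_pmulr.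
have I2 : 3 * \sum_(i in O) F i <= \sum_(i in O) F i ^ 2 + 2 * #|O|.
  rewrite big_distrr mulnC -sum_nat_const -big_split; apply: leq_sum => i _ /=.
  by case: (F i) => [|[|n]] //; rewrite -mulnn; nia.
have I3 := cauchy_sum O F.
move: I1 I2 I3 Q; rewrite L cO; set q := \sum_(i in O) _.
move=> I1 I2 I3 Q.
have [?|lt_c] := leqP mu.*2 c; first by left; apply/andP.
(* [j] is the deficit k - c, at least 2 from here on, and [p] below is the second moment divided by
   [c]. *)
right; have [j jc] : exists j, c + j = mu.*2.+1 by exists (mu.*2.+1 - c); lia.
have [p qp] : exists p, q = c * p.
  by exists (mu.*2 + (c - 1) * (mu - 1) - mu ^ 2); rewrite mulnBr -Q addnK.
subst q; rewrite {}qp in I1 I2 I3 Q.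
have Q' : p + mu ^ 2 = mu.*2 + (c - 1) * (mu - 1).
  by apply/eqP; rewrite -(eqn_pmul2l c_gt0) mulnDr Q.
have I1' : mu <= p by rewrite -(leq_pmul2l c_gt0).
have I3' : c * mu ^ 2 <= (mu.*2.+1.*2 - c) * p by rewrite -(leq_pmul2l c_gt0); move: I3; rewrite -!mulnn; lia.
have pE : p + j * mu = mu * mu + j.
  move: Q'; rewrite -mulnn.
  have [m mE] : exists m, mu = m.+1 by exists mu.-1; lia.
  have [c' cE] : exists c', c = c'.+1 by exists c.-1; lia.
  have := congr1 (muln m) jc; rewrite cE mE; lia.
(* Cauchy-Schwarz after substituting p = mu^2 - j (mu - 1) and dividing by [j]. It leaves only (j,
   mu) = (2, 2), (3, 2) and (2, 3). *)
have jle : (j - 1) * (mu - 1) <= 2.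
  have h1 := congr1 (muln (mu * mu)) jc.
  have h2 := congr1 (muln (mu.*2.+1 + j)) pE.
  have h3 : mu.*2.+1.*2 - c = mu.*2.+1 + j by lia.
  rewrite h3 -mulnn in I3'.
  have h4 : j * (j * mu) <= j * (mu + 1 + j) by move: I3' h1 h2; lia.
  have : j * mu <= mu + 1 + j by rewrite leq_pmul2l in h4; lia.
  have [m mE] : exists m, mu = m.+1 by exists mu.-1; lia.
  have [j' jE] : exists j', j = j'.+1 by exists j.-1; lia.
  by rewrite mE jE !subn1 /=; lia.
have j_gt1 : 1 < j by lia.
have j_le3 : j <= 3.
  have : j - 1 <= (j - 1) * (mu - 1) by rewrite leq_pmulr // subn_gt0.
  by lia.
have mu_le3 : mu <= 3.
  have : mu - 1 <= (j - 1) * (mu - 1) by rewrite leq_pmull // subn_gt0.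
  by lia.
rewrite -!mulnn in Q' I2.
(* The pair (3, 2) gives [p = 1], against [mu <= p]; the pair (2, 3) gives [c = p = 5], and then
   [I2] would read 45 <= 43. *)
have [E|E] : mu = 2 \/ mu = 3 by lia.
  rewrite {}E in pE I1' jc lt_c jle *; split=> //.
  have [E|E] : j = 2 \/ j = 3 by lia.
    by rewrite E in jc; lia.
  by rewrite E in pE; lia.
have j2 : j = 2 by rewrite {}E in jle; lia.
exfalso; rewrite {}E {}j2 in pE I2 jc lt_c.
have c5 : c = 5 by lia.
have p5 : p = 5 by lia.
by rewrite c5 p5 in I2.
Qed.

Lemma muC x y : d x y = 2 -> #|N y :&: N x| = mu.
Proof. by rewrite setIC; apply: muE. Qed.

(** * Propagation from one neighbour of x to all of Gamma_2(x) *)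

Lemma mid_full x z a : d x z = 4 -> e x a ->
  mu.*2 <= #|N a :&: sphere e 2 z| -> N a :&: sphere e 2 z = N a :\ x.
Proof.
move=> dxz exa cge; apply/eqP; rewrite eqEcard; apply/andP; split.
  apply/subsetP=> y; rewrite !memE => /andP[-> /eqP dzy]; rewrite andbT.
  by apply/eqP=> yx; rewrite yx dist_sym dxz in dzy.
by rewrite nbhd_split // card_nbhd_split.
Qed.

(** The vertices [a] and [p] share [mu > 1] neighbours, so one besides [x]; as a neighbour of [a]
    other than [x] it is at distance 2 from [z]. *)
Lemma mid_full_dist3 x z a p : d x z = 4 -> e x a ->
  mu.*2 <= #|N a :&: sphere e 2 z| -> e x p -> exists2 m, e p m & d z m = 2.
Proof.
move=> dxz exa cge exp.
have eqN := mid_full dxz exa cge.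
case: (p =P a) => [->|/eqP pa].
  have : 0 < #|N a :&: sphere e 2 z| by lia.
  by case/card_gt0P=> m; rewrite !memE => /andP[eam /eqP dzm]; exists m.
have epx : e p x by rewrite e_sym.
have := card_common epx exa pa; rewrite (cardsD1 x) !memE !(e_sym _ x) exp exa /= => cm.
have : 0 < #|(N p :&: N a) :\ x| by lia.
case/card_gt0P=> m; rewrite !memE => /and3P[mx epm eam]; exists m => //.
by apply/eqP; move/setP/(_ m): eqN; rewrite !memE mx eam.
Qed.

(** For [mu > 2] a neighbour of [x] with one neighbour in Gamma_2(z) has at least [2 mu], that is,
    all but [x]. A geodesic supplies one such neighbour, and the property passes to the others. *)
Lemma diametral_torus x z : 2 < mu -> d x z = 4 -> sphere e 2 x \subset sphere e 2 z.
Proof.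
move=> mu3 dxz.
have cge a m : e x a -> e a m -> d z m = 2 -> mu.*2 <= #|N a :&: sphere e 2 z|.
  move=> exa eam dzm; have dmz : d m z = 2 by rewrite dist_sym.
  have [daz _] := diametral_nbr3 dxz exa eam dmz.
  by rewrite dist_sym in daz; have := mid3_bound daz; lia.
have [m0 [dxm0 dm0z]] := diametral_mid_ex dxz.
have [a0 da0 ea0m0] := dist_pred dxm0; have exa0 : e x a0 by rewrite -dist1 da0.
have c0 : mu.*2 <= #|N a0 :&: sphere e 2 z| by apply: cge ea0m0 _ => //; rewrite dist_sym.
apply/subsetP=> i; rewrite !memE => /eqP dxi.
have [p dp epi] := dist_pred dxi; have exp : e x p by rewrite -dist1 dp.
have [m epm dzm] := mid_full_dist3 dxz exa0 c0 exp.
have cp := cge _ _ exp epm dzm.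
have := mid_full dxz exp cp.
move/setP/(_ i); rewrite !memE epi andbT /= => ->.
by apply/eqP=> ix; rewrite ix distxx in dxi.
Qed.

(** * Structure around a pair with Gamma_2(x) = Gamma_2(z) *)

Section Torus.
Variables x z : T.
Hypothesis dxz : d x z = 4.
Hypothesis torus : sphere e 2 x \subset sphere e 2 z.

Lemma torus_eq y : (d x y == 2) = (d z y == 2).
Proof.
have /eqP/setP/(_ y) : sphere e 2 x == sphere e 2 z by rewrite eqEcard torus !card_sphere2 leqnn.
by rewrite !memE.
Qed.

Lemma torus_nbr b y : e z b -> e b y -> y = z \/ d x y = 2.
Proof.
move=> ezb eby; case: (y =P z) => [|/eqP yz]; first by left.
by right; apply/eqP; rewrite torus_eq (dist_two ezb eby) // eq_sym.
Qed.

Lemma torus_nbr_dist b : e z b -> d x b = 3.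
Proof.
move=> ezb; have : 0 < #|N b :\ z| by rewrite nbhd_split // card_nbhd_split //; lia.
case/card_gt0P=> y; rewrite !memE => /andP[/eqP yz eby].
have [//|dxy] := torus_nbr ezb eby.
by have := dist_edge2 x eby; have := dist_edge2 x ezb; lia.
Qed.

(** If [m] and [m'] were adjacent, a neighbour [a] of [x] and [m] would share with [m'] a second
    vertex [t] of Gamma_2(x). Then [m'] would have two neighbours outside [N x] and [N z], where
    there is room for one. *)
Lemma torus_S2_stable m m' : d x m = 2 -> d x m' = 2 -> e m m' = false.
Proof.
move=> dxm dxm'; apply/negP=> emm'.
have [a da eam] := dist_pred dxm; have exa : e x a by rewrite -dist1 da.
have am' : a != m' by apply/eqP=> am'; rewrite am' dxm' in da.
have : 1 < #|N a :&: N m'| by rewrite (card_common eam emm').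
rewrite (cardsD1 m) !memE eam e_sym emm' => /card_gt0P[t]; rewrite !memE => /and3P[tm eat em't].
have dxt : d x t = 2.
  apply: dist_two exa eat _; apply/eqP=> xt.
  by have := dist1 x m'; rewrite dxm' xt e_sym em't.
have : #|N m' :&: N x| + #|N m' :&: N z| + 2 <= #|N m'|.
  have -> : #|N m' :&: N x| + #|N m' :&: N z| = #|N m' :&: (N x :|: N z)|.
    rewrite setIUr cardsU (_ : N m' :&: N x :&: (N m' :&: N z) = N m' :&: N x :&: N z).
      by rewrite diametral_nbr_disj // cards0 subn0.
    by apply/setP=> y; rewrite !memE; case: (e m' y).
  rewrite -(cardsID (N x :|: N z) (N m')) leq_add2l.
  have <- : #|[set m; t]| = 2 by rewrite cards2 eq_sym tm.
  apply/subset_leq_card/subsetP=> y; rewrite in_set2 !memE => ymt.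
  have dxy : d x y = 2 by case/orP: ymt => /eqP->.
  have -> : e m' y by case/orP: ymt => /eqP-> //; rewrite e_sym.
  rewrite andbT negb_or -!dist1 dxy /=.
  by have /eqP-> : d z y == 2 by rewrite -torus_eq dxy.
have dzm' : d z m' = 2 by apply/eqP; rewrite -torus_eq dxm'.
by rewrite (muC dxm') (muC dzm') regE; lia.
Qed.

(** This becomes the cell [D3'], with [N z] as [D3]. *)
Definition torus_rest := sphere e 3 x :\: N z.
Local Notation R := torus_rest.

Lemma torus_nbr_S2 m y : d x m = 2 -> e m y -> [\/ e x y, e z y | y \in R].
Proof.
move=> dxm emy; rewrite !memE; case: (boolP (e z y)) => ezy; first by constructor 2.
case: (boolP (e x y)) => exy; first by constructor 1.
constructor 3 => /=; have := dist_edge2 x emy; have := dist1 x y; rewrite (negbTE exy).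
have : d x y <> 2 by move=> dxy; have := torus_S2_stable dxm dxy; rewrite emy.
have : d x y <> 0 by move/eqP; rewrite dist0 => /eqP xy; have := dist1 m x; rewrite dist_sym dxm xy emy.
by lia.
Qed.

Lemma card_nbr_rest m : d x m = 2 -> #|N m :&: R| = 1.
Proof.
move=> dxm; have dzm : d z m = 2 by apply/eqP; rewrite -torus_eq dxm.
have := cardsID (N x :|: N z) (N m); rewrite setIUr cardsU.
have -> : N m :&: N x :&: (N m :&: N z) = N m :&: N x :&: N z.
  by apply/setP=> y; rewrite !memE; case: (e m y).
rewrite diametral_nbr_disj // cards0 regE (muC dxm) (muC dzm).
have -> : N m :\: (N x :|: N z) = N m :&: R; last by lia.
apply/setP=> y; rewrite !memE andbC; case: (boolP (e m y)) => //= emy.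
rewrite negb_or; have := torus_nbr_S2 dxm emy; rewrite !memE.
case: (boolP (e x y)) => /= [|_]; last by case: (e z y); case=> // -[].
by rewrite -dist1 => /eqP->; rewrite andbF.
Qed.

(* Three such neighbours of [r] pairwise share [r] and a vertex of [N x], so they would need six
   distinct neighbours among the five of [z]. *)
Lemma rest_mid_ne3 r : r \in R -> mu = 2 -> #|N r :&: sphere e 2 x| <> 3.
Proof.
rewrite !memE => /andP[ezr /eqP dxr] mu2 c3.
have := sum_nbhd (N r :&: sphere e 2 x) (N z).
rewrite (@sum_const_on _ _ 2) => [|m]; last first.
  rewrite !memE => /andP[_ dxm]; rewrite -mu2; apply: muE; apply/eqP.
  by rewrite dist_sym -torus_eq.
rewrite c3; suff : \sum_(b in N z) #|N b :&: (N r :&: sphere e 2 x)| <= #|N z| * 1.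
  by rewrite regE mu2; lia.
rewrite -sum_nat_const; apply: leq_sum => b; rewrite memE => ezb.
apply/card_le1_eqP=> m m'; rewrite !memE => /and3P[ebm erm /eqP dxm] /and3P[ebm' erm' /eqP dxm'].
apply/eqP/negPn/negP; rewrite eq_sym => mm'.
have emr : e m r by rewrite e_sym.
have cm := card_common emr erm' mm'.
have sub t : d x t = 2 -> e r t -> N t :&: N x \subset N x :&: sphere e 2 r.
  move=> dxt ert; apply/subsetP=> y; rewrite !memE => /andP[ety exy].
  by have [_ ->] := dist2_mid dxr ert exy ety; rewrite exy.
have : 0 < #|(N m :&: N x) :&: (N m' :&: N x)|.
  have := subset_leq_card (_ : (N m :&: N x) :|: (N m' :&: N x) \subset N x :&: sphere e 2 r).
  rewrite subUset !sub // -card_mid3 // c3 => /(_ isT).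
  by rewrite cardsU (muC dxm) (muC dxm') mu2; lia.
case/card_gt0P=> y; rewrite !memE => /andP[/andP[emy exy] /andP[em'y _]].
have : #|[set r; b; y]| <= #|N m :&: N m'|.
  apply/subset_leq_card/subsetP=> t; rewrite !inE => /orP[/orP[]|] /eqP->.
  - by rewrite emr e_sym erm'.
  - by rewrite !(e_sym _ b) ebm ebm'.
  - by rewrite emy em'y.
have rb : r != b by apply/eqP=> rb; rewrite rb ezb in ezr.
have ry : r != y by apply/eqP=> ry; rewrite ry -dist1 in dxr exy *; rewrite dxr in exy.
have yb : b != y by apply/eqP=> yb; have := torus_nbr_dist ezb; move: exy; rewrite yb -dist1 => /eqP->.
by rewrite -setUA cardsU1 cards2 !inE negb_or rb ry yb cm mu2.
Qed.

(** Each of the 2k vertices of Gamma_2(x) sends one edge to [R], and each vertex of [R] receives k -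
    1 or k of them; since k >= 5 this forces two vertices receiving k each. *)
Lemma torus_rest_card : #|R| = 2 /\ forall r, r \in R -> #|N r :&: sphere e 2 x| = mu.*2.+1.
Proof.
have bd r : r \in R -> mu.*2 <= #|N r :&: sphere e 2 x| <= mu.*2.+1.
  move=> rR; have dxr : d x r = 3 by move: rR; rewrite !memE => /andP[_ /eqP].
  by have [//|[mu2 c3]] := mid3_bound dxr; have := rest_mid_ne3 rR mu2.
have S : \sum_(r in R) #|N r :&: sphere e 2 x| = mu.*2.+1.*2.
  rewrite sum_nbhd (@sum_const_on _ _ 1) ?card_sphere2 ?muln1 // => m.
  by rewrite memE => /eqP; apply: card_nbr_rest.
have lo : #|R| * mu.*2 <= mu.*2.+1.*2.
  by rewrite -S -sum_nat_const; apply: leq_sum => r /bd/andP[].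
have hi : mu.*2.+1.*2 <= #|R| * mu.*2.+1.
  by rewrite -S -sum_nat_const; apply: leq_sum => r /bd/andP[].
have R2 : #|R| = 2.
  have : 2 <= #|R| by rewrite -(leq_pmul2r (ltn0Sn mu.*2)); lia.
  have [|//] := leqP #|R| 2; first by lia.
  by move=> R3 _; have := leq_mul R3 (leqnn mu.*2); lia.
split=> // r rR; have := S; rewrite (bigD1 r) //=.
have : \sum_(i in R | i != r) #|N i :&: sphere e 2 x| <= mu.*2.+1.
  have -> : mu.*2.+1 = #|R :\ r| * mu.*2.+1.
    by move: R2; rewrite (cardsD1 r) rR add1n => -[->]; rewrite mul1n.
  rewrite -sum_nat_const (eq_bigl [in R :\ r]) => [|i]; last by rewrite in_setD1 andbC.
  by apply: leq_sum => i; rewrite in_setD1 => /andP[_ /bd/andP[]].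
by have := bd r rR; lia.
Qed.

Lemma torus_rest_nbr r y : r \in R -> e r y -> d x y = 2.
Proof.
move=> rR ery; have [_ /(_ r rR) c] := torus_rest_card.
have /eqP/setP/(_ y) : N r :&: sphere e 2 x == N r by rewrite eqEcard subsetIl regE c leqnn.
by rewrite !memE ery /= => /eqP.
Qed.

Lemma torus_S3 y : d x y = 3 -> e z y \/ y \in R.
Proof. by move=> dxy; rewrite !memE dxy andbT; case: (e z y); [left|right]. Qed.

Lemma torus_S4 y : d x y = 4 -> y = z.
Proof.
move=> dxy; have [t dxt ety] := dist_pred dxy.
case: (torus_S3 dxt) => [ezt|tR].
  by case: (torus_nbr ezt ety) => // dxy'; rewrite dxy' in dxy.
by have := torus_rest_nbr tR ety; rewrite dxy.
Qed.

(** No sphere around [x] contains an edge, so parity of the distance from [x] is a proper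
    2-colouring. *)
Lemma torus_level y t : e y t -> d x t = (d x y).+1 \/ d x y = (d x t).+1.
Proof.
move=> eyt; have := dist_edge2 x eyt.
suff : d x y <> d x t by lia.
move=> dyt; have := dist_le4 x y; case E : (d x y) => [|[|[|[|[|//]]]]] // _.
- move: dyt; rewrite E => /esym/eqP; move/eqP: E; rewrite !dist0 => /eqP xy /eqP xt.
  by rewrite -xt -xy e_irr in eyt.
- by move: dyt; rewrite E => /esym/eqP; move/eqP: E; rewrite !dist1 => exy; rewrite (no_triangle exy eyt).
- by have := torus_S2_stable E (_ : d x t = 2); rewrite eyt -dyt E => /(_ erefl).
- case: (torus_S3 E) => [ezy|yR].
    by case: (torus_nbr ezy eyt) => [tz|dxt]; [move: dxz; rewrite -tz -dyt E | rewrite dxt E in dyt].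
  by have := torus_rest_nbr yR eyt; rewrite -dyt E.
- have yz := torus_S4 E; rewrite E in dyt; have tz := torus_S4 (esym dyt).
  by rewrite yz tz e_irr in eyt.
Qed.

End Torus.

(** * The equitable partition, and its transfer to every vertex *)

Section TorusConclusion.
Variables x z : T.
Hypothesis dxz : d x z = 4.
Hypothesis torus : sphere e 2 x \subset sphere e 2 z.
Local Notation R := (torus_rest x z).

Lemma torus_parity y t : e y t -> odd (d x y) != odd (d x t).
Proof.
by case/(torus_level dxz torus) => -> /=; case: (odd _).
Qed.

Lemma torus_S3_split : N z :|: R = sphere e 3 x /\ N z :&: R = set0.
Proof.
split; apply/setP=> y; rewrite !memE; case: (boolP (e z y)) => ezy //=.
by rewrite (torus_nbr_dist dxz torus ezy).
Qed.

(** There are k + (k + 2) vertices at odd distance from [x], but only 2k + 1 vertices in {a} and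
    Gamma_2(a) together. A leftover [u] is at even distance from [a] by parity, hence at distance
    4. *)
Lemma torus_ecc_nbr a : e x a -> exists u, d a u = 4.
Proof.
move=> exa; have dxa : d x a = 1 by apply/eqP; rewrite dist1.
have [defS3 disj] := torus_S3_split; have [R2 _] := torus_rest_card dxz torus.
pose O := N x :|: sphere e 3 x.
have cO : #|O| = mu.*2.+1.*2 + 2.
  rewrite /O cardsU (_ : N x :&: sphere e 3 x = set0).
    by rewrite -defS3 cardsU disj !cards0 R2 !regE; lia.
  by apply/setP=> y; rewrite !memE -dist1; case: eqP => // ->.
have : ~~ (O \subset a |: sphere e 2 a).
  apply: contraTN isT => /subset_leq_card; rewrite cO.
  by have := cardsU1 a (sphere e 2 a); rewrite card_sphere2 => ->; case: (a \in _) => /=; lia.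
case/subsetPn=> u; rewrite !memE negb_or -dist1 => du /andP[ua du2].
have du_odd : odd (d x u) by case/orP: du => /eqP->.
have a0 : d a u <> 0 by move/eqP; rewrite dist0 eq_sym (negbTE ua).
have a1 : d a u <> 1 by move/eqP; rewrite dist1 => /torus_parity; rewrite dxa du_odd.
have a3 : d a u <> 3.
  move=> da3; have [q daq equ] := dist_pred da3; have [p /eqP dap epq] := dist_pred daq.
  rewrite dist1 in dap.
  have := torus_parity dap; have := torus_parity epq; have := torus_parity equ.
  by rewrite du_odd dxa; case: (odd (d x p)); case: (odd (d x q)).
by exists u; have := dist_le4 a u; move/eqP: du2; lia.
Qed.

Lemma nbrs_inE y (A : {set T}) : nbrs_in e y A = #|N y :&: A|.
Proof. by apply: eq_card => t; rewrite !memE in_set andbC. Qed.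

Lemma torus_equitable : equitable_with e (thm_cells e x (N z) R) (thm_quot mu.*2.+1).
Proof.
have dist_z b : e z b -> d x b = 3 by exact: torus_nbr_dist.
pose lvl (i : 'I_6) := nth 0 [:: 0; 1; 2; 3; 3; 4] i.
have cellP (i : 'I_6) y : y \in thm_cells e x (N z) R i =
    (d x y == lvl i) && ((i == 3 :> nat) ==> e z y) && ((i == 4 :> nat) ==> ~~ e z y).
  case: i => -[|[|[|[|[|[|//]]]]]] i_lt; rewrite /thm_cells /lvl /= ?memE ?andbT ?dist0 //.
  - by case: (boolP (e z y)) => [/dist_z->//|_]; rewrite andbF.
  - by rewrite andbC.
have restP y : d x y = 3 -> ~~ e z y -> y \in R by move=> dxy ezy; rewrite !memE dxy ezy.
(* The support of [thm_quot]. Off it, cells on nonconsecutive levels have no edge between them; the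
   only other case is [D3'] against Gamma_4(x), settled by [torus_rest_nbr]. *)
pose adj : seq (nat * nat) :=
  [:: (0, 1); (1, 0); (1, 2); (2, 1); (2, 3); (2, 4); (3, 2); (3, 5); (4, 2); (5, 3)].
have halfE : (mu.*2.+1 - 1) %/ 2 = mu by rewrite subn1 divn2 doubleK.
have S1 : sphere e 1 x = N x by apply/setP=> t; rewrite !memE dist1.
move=> i j y yi; rewrite nbrs_inE.
have [|nij] := boolP ((val i, val j) \in adj); last first.
  have -> : thm_quot mu.*2.+1 i j = 0.
    by case: i yi nij => -[|[|[|[|[|[|//]]]]]] ?; case: j => -[|[|[|[|[|[|//]]]]]] ?.
  apply/eqP; rewrite cards_eq0; apply/eqP/setP=> t; rewrite in_setI memE in_set0.
  apply/negP=> /andP[eyt]; move: yi; rewrite !cellP => /andP[/andP[/eqP yl yz] yr] /andP[/andP[/eqP tl tz] tr].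
  have := torus_level dxz torus eyt.
  case: i j nij yl yz yr tl tz tr => [[|[|[|[|[|[|//]]]]]] i_lt] [[|[|[|[|[|[|//]]]]]] j_lt];
    rewrite /lvl //= => _ yl yz yr tl tz tr; rewrite ?yl ?tl //; try by [case; lia].
  - by have := torus_rest_nbr dxz torus (restP _ yl yr) eyt; rewrite tl.
  - by have := torus_rest_nbr dxz torus (restP _ tl tr) (_ : e t y); rewrite e_sym yl => /(_ eyt).
move: yi; rewrite cellP.
case: i j => [[|[|[|[|[|[|//]]]]]] i_lt] [[|[|[|[|[|[|//]]]]]] j_lt];
  rewrite /lvl // /thm_cells /thm_quot /= ?andbT => yi _.
- move: yi; rewrite dist0 S1 => /eqP<-; by rewrite setIid regE.
- move: yi; rewrite dist1 => exy; rewrite (setIidPr _) ?cards1 // sub1set memE e_sym //.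
- by move: yi; rewrite dist1 subn1 => exy; rewrite card_nbhd_split.
- by rewrite S1 halfE muC //; apply/eqP.
- by rewrite halfE muC // dist_sym; apply/eqP; rewrite dist_sym -(torus_eq torus).
- by apply: card_nbr_rest => //; apply/eqP.
- have ezy : e z y by case/andP: yi.
  have S2 : sphere e 2 x = sphere e 2 z by apply/setP=> t; rewrite !memE (torus_eq torus).
  by rewrite S2 subn1 card_nbhd_split.
- have ezy : e z y by case/andP: yi.
  rewrite (_ : N y :&: _ = [set z]) ?cards1 //; apply/setP=> t; rewrite !memE.
  apply/andP/eqP => [[_ /eqP/(torus_S4 dxz torus)]//|->].
  by rewrite e_sym ezy dxz.
- by case/andP: yi => /eqP dxy ezy; have [_ ->] := torus_rest_card dxz torus; rewrite ?restP.
- by have /eqP/(torus_S4 dxz torus)-> := yi; rewrite setIid regE.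
Qed.

End TorusConclusion.

Section AllTorus.
Hypothesis conn : connected_graph e.
Hypothesis all_torus : forall x z, d x z = 4 -> sphere e 2 x \subset sphere e 2 z.

Lemma all_ecc4 x0 z0 x : d x0 z0 = 4 -> exists z, d x z = 4.
Proof.
move=> d0; case/connectP: (conn x0 x) => p; elim: p x0 z0 d0 => [|y p IHp] x0 z0 d0 /=.
  by move=> _ ->; exists z0.
case/andP=> e0 path_p lastp.
by have [u du] := torus_ecc_nbr d0 (all_torus d0) e0; apply: (IHp _ _ du).
Qed.

Lemma all_torus_conclusion x0 z0 : d x0 z0 = 4 ->
  bipartite e /\
   forall x : T, exists D3 D3' : {set T},
     [/\ D3 :|: D3' = sphere e 3 x, D3 :&: D3' = set0,
         [/\ #|sphere e 1 x| = mu.*2.+1, #|sphere e 2 x| = mu.*2.+1.*2, #|D3| = mu.*2.+1,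
             #|D3'| = 2 & #|sphere e 4 x| = 1] &
         equitable_with e (thm_cells e x D3 D3') (thm_quot mu.*2.+1)].
Proof.
move=> d0; split.
  exists (fun y => odd (d x0 y)) => y t; exact: torus_parity (all_torus d0) _ _.
move=> x; have [z dxz] := all_ecc4 x d0; have tor := all_torus dxz.
have [U0 I0] := torus_S3_split dxz tor; have [R2 _] := torus_rest_card dxz tor.
exists (N z), (torus_rest x z); split=> //; last exact: torus_equitable.
split=> //; rewrite ?card_sphere2 ?regE //.
  by rewrite -(regE x); apply: eq_card => y; rewrite !memE dist1.
apply/eqP/cards1P; exists z; apply/setP=> y; rewrite !memE.
by apply/eqP/eqP=> [/(torus_S4 dxz tor)|->].
Qed.

End AllTorus.

(** * The case mu = 2, k = 5: vertices forced by second common neighbours *)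

Section Sporadic.
Hypothesis mu2 : mu = 2.

Lemma card_common2 a t c : e a t -> e t c -> a != c -> #|N a :&: N c| = 2.
Proof. by move=> eat etc ac; rewrite (card_common eat etc ac). Qed.

Lemma common3F a c t1 t2 t3 : a != c -> uniq [:: t1; t2; t3] ->
  all (e a) [:: t1; t2; t3] -> all (e c) [:: t1; t2; t3] -> False.
Proof.
move=> ac us; rewrite /= !andbT => /and3P[a1 a2 a3] /and3P[c1 c2 c3].
have := card_common2 a1 (_ : e t1 c) ac; rewrite e_sym => /(_ c1) c2'.
have : [set t in [:: t1; t2; t3]] \subset N a :&: N c.
  by apply/subsetP=> t; rewrite !memE !inE => /or3P[]/eqP->; rewrite ?a1 ?a2 ?a3.
by move/subset_leq_card; rewrite cardsE (card_uniqP us) c2'.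
Qed.

Lemma nbr_five a (s : seq T) : uniq s -> size s = 5 -> all (e a) s -> forall y, e a y = (y \in s).
Proof.
move=> us s5 /allP sa y.
have /eqP/setP/(_ y) : [set t in s] == N a.
  rewrite eqEcard regE mu2 cardsE (card_uniqP us) s5 andbT.
  by apply/subsetP=> t; rewrite memE inE => /sa.
by rewrite memE inE => ->.
Qed.

Section Rest.
Variables x z : T.
Hypothesis dxz : d x z = 4.
Local Notation I := (N x :|: N z).

(* Both default to the argument when no neighbour is left over. *)
Definition rest m := odflt m [pick t in N m :\: I].
Definition fifth y := odflt y [pick t in N y :\ z :\: sphere e 2 x].

Lemma restE m : d x m = 2 -> d z m = 2 -> N m :\: I = [set rest m].
Proof.
move=> dxm dzm; have /eqP/cards1P[t tE] : #|N m :\: I| = 1 by rewrite rest_card // dist_sym.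
rewrite /rest tE.
by case: pickP => [t'|/(_ t)]; rewrite !memE ?eqxx // => /eqP->.
Qed.

Lemma restP m : d x m = 2 -> d z m = 2 -> [/\ e m (rest m), ~~ e x (rest m) & ~~ e z (rest m)].
Proof.
move=> dxm dzm; have := set11 (rest m); rewrite -restE // !memE negb_or.
by case/andP=> /andP[].
Qed.

Lemma rest_uniq m t : d x m = 2 -> d z m = 2 -> e m t -> ~~ e x t -> ~~ e z t -> t = rest m.
Proof.
move=> dxm dzm emt ext ezt; apply/set1P.
by rewrite -restE // !memE emt (negbTE ext) (negbTE ezt).
Qed.

Lemma common_inner m m' : m != m' -> 0 < #|N m :&: N m' :&: I| ->
  #|N m :&: N m' :&: I| + #|(N m :&: N m') :\: I| = 2.
Proof.
move=> mm' /card_gt0P[t]; rewrite !memE => /andP[/andP[emt em't] _].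
by rewrite cardsID (card_common2 emt _ mm') // e_sym.
Qed.

(** The second common neighbour lies outside [I], where [m] and [m'] have one neighbour each. *)
Lemma rest_eq m m' : d x m = 2 -> d z m = 2 -> d x m' = 2 -> d z m' = 2 -> m != m' ->
  #|N m :&: N m' :&: I| = 1 -> rest m = rest m'.
Proof.
move=> dxm dzm dxm' dzm' mm' c1; have := common_inner mm'; rewrite c1 add1n => /(_ isT) [c].
have /card_gt0P[t] : 0 < #|(N m :&: N m') :\: I| by rewrite c.
rewrite !memE negb_or => /and3P[/andP[ext ezt] emt em't].
by rewrite -(rest_uniq dxm dzm emt ext ezt) (rest_uniq dxm' dzm' em't ext ezt).
Qed.

Lemma rest_ne m m' : d x m = 2 -> d z m = 2 -> d x m' = 2 -> d z m' = 2 -> m != m' ->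
  #|N m :&: N m' :&: I| = 2 -> rest m <> rest m'.
Proof.
move=> dxm dzm dxm' dzm' mm' c2 eqr; have := common_inner mm'; rewrite c2 => /(_ isT).
have [emr xr zr] := restP dxm dzm; have [em'r _ _] := restP dxm' dzm'.
by rewrite -eqr in em'r; rewrite (cardsD1 (rest m)) !memE emr em'r (negbTE xr) (negbTE zr).
Qed.

(** No neighbour of [i] is next to [z], so the second common neighbour of [m] and [i] can only be
    [rest m]. *)
Lemma rest_adj_far m i : d x m = 2 -> d z m = 2 -> d x i = 2 -> d z i <> 2 -> m != i ->
  #|N m :&: N i :&: N x| = 1 -> e (rest m) i.
Proof.
move=> dxm dzm dxi dzi mi c1.
have eqI : N m :&: N i :&: I = N m :&: N i :&: N x.
  rewrite setIUr; apply/setUidPl/subsetP=> b; rewrite !memE => /andP[/andP[_ eib] ezb].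
  case: dzi; apply: dist_two ezb _ _; first by rewrite e_sym.
  by apply/eqP=> zi; move: dxi; rewrite -zi dxz.
have := common_inner mi; rewrite eqI c1 add1n => /(_ isT) [c].
have /card_gt0P[t] : 0 < #|(N m :&: N i) :\: I| by rewrite c.
rewrite !memE negb_or => /and3P[/andP[ext ezt] emt eit].
by rewrite -(rest_uniq dxm dzm emt ext ezt) e_sym.
Qed.

Lemma fifthE y : e z y -> #|N y :&: sphere e 2 x| = 3 -> N y :\ z :\: sphere e 2 x = [set fifth y].
Proof.
move=> ezy c3; have : #|N y :\ z :\: sphere e 2 x| = 1.
  have := cardsID (sphere e 2 x) (N y :\ z); have := regE y; rewrite (cardsD1 z) memE e_sym ezy mu2.
  suff -> : (N y :\ z) :&: sphere e 2 x = N y :&: sphere e 2 x by rewrite c3; lia.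
  by apply/setP=> t; rewrite !memE; case: (t =P z) => //= ->; rewrite dxz andbF.
move/eqP/cards1P=> [t tE]; rewrite /fifth tE.
by case: pickP => [t'|/(_ t)]; rewrite !memE ?eqxx // => /eqP->.
Qed.

Lemma fifthP y : e z y -> #|N y :&: sphere e 2 x| = 3 ->
  [/\ e y (fifth y), fifth y != z & d x (fifth y) <> 2].
Proof.
move=> ezy c3; have := set11 (fifth y); rewrite -fifthE // !memE.
by case/and3P=> /eqP ? ? ?.
Qed.

Lemma fifth_uniq y t : e z y -> #|N y :&: sphere e 2 x| = 3 -> e y t -> t != z -> d x t <> 2 ->
  t = fifth y.
Proof. by move=> ezy c3 eyt tz /eqP dt; apply/set1P; rewrite -fifthE // !memE eyt tz dt. Qed.

Lemma dist_mid_z y m : d x m = 2 -> e z y -> e y m -> d z m = 2.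
Proof.
move=> dxm ezy eym; apply: dist_two ezy eym _.
by apply/eqP=> zm; move: dxm; rewrite -zm dxz.
Qed.

(** Besides [m], [y] and [rest m] share another vertex. It is not [z], and not on the face [y]
    because there no other vertex has the same [rest]; what remains is [fifth y]. *)
Lemma rest_adj_fifth m y : d x m = 2 -> e z y -> e y m -> #|N y :&: sphere e 2 x| = 3 ->
  (forall m', d x m' = 2 -> e y m' -> m' != m -> rest m' <> rest m) -> e (rest m) (fifth y).
Proof.
move=> dxm ezy eym c3 sep; have dzm := dist_mid_z dxm ezy eym.
have [emr xr zr] := restP dxm dzm.
have yr : y != rest m by apply: contraNneq zr => <-.
have := card_common2 eym emr yr; rewrite (cardsD1 m) !memE eym e_sym emr add1n => -[c].
have /card_gt0P[t] : 0 < #|(N y :&: N (rest m)) :\ m| by rewrite c.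
rewrite !memE => /and3P[tm eyt ert]; rewrite -(fifth_uniq (t := t)) //.
  by apply: contraNneq zr => <-; rewrite e_sym.
move=> dxt; apply: (sep t dxt eyt tm); apply/esym; apply: rest_uniq => //.
  exact: dist_mid_z dxt ezy eyt.
by rewrite e_sym.
Qed.

Lemma fifth_eq y y' : e z y -> e z y' -> y != y' ->
  #|N y :&: sphere e 2 x| = 3 -> #|N y' :&: sphere e 2 x| = 3 ->
  N y :&: N y' :&: sphere e 2 x = set0 -> fifth y = fifth y'.
Proof.
move=> ezy ezy' yy' c3 c3' c0; have eyz : e y z by rewrite e_sym.
have := card_common2 eyz ezy' yy'; rewrite (cardsD1 z) !memE eyz (e_sym y') ezy' add1n => -[c].
have /card_gt0P[t] : 0 < #|(N y :&: N y') :\ z| by rewrite c.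
rewrite !memE => /and3P[tz eyt ey't].
have dxt : d x t <> 2 by move=> dxt; move/setP/(_ t): c0; rewrite !memE eyt ey't dxt.
by rewrite -(fifth_uniq ezy c3 eyt tz dxt); apply: fifth_uniq.
Qed.

(** Otherwise [z], [m] and the fifth vertex would be three common neighbours of [y] and [y']. *)
Lemma fifth_ne y y' m : e z y -> e z y' -> y != y' ->
  #|N y :&: sphere e 2 x| = 3 -> #|N y' :&: sphere e 2 x| = 3 ->
  d x m = 2 -> e y m -> e y' m -> fifth y <> fifth y'.
Proof.
move=> ezy ezy' yy' c3 c3' dxm eym ey'm eqf.
have [eyf fz df] := fifthP ezy c3; have [ey'f _ _] := fifthP ezy' c3'.
apply: (@common3F y y' z m (fifth y)) => //=.
- rewrite !inE negb_or (eq_sym z (fifth y)) fz andbT andbT; apply/andP; split.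
    by apply/eqP=> zm; move: dxm; rewrite -zm dxz.
  by apply/eqP=> mf; rewrite -mf in df.
- by rewrite e_sym ezy eym eyf.
- by rewrite e_sym ezy' ey'm eqf ey'f.
Qed.

End Rest.

(** The fourth vertex of the quadrangle through [a], [x], [a']; it stands for the pair of neighbours
    [a], [a'] of [x]. *)
Definition pp x a a' := odflt x [pick t in (N a :&: N a') :\ x].

Lemma ppE x a a' : e x a -> e x a' -> a != a' ->
  N a :&: N a' = [set x; pp x a a'] /\ pp x a a' != x.
Proof.
move=> exa exa' aa'; have eax : e a x by rewrite e_sym.
have := card_common2 eax exa' aa'; rewrite (cardsD1 x) !memE eax (e_sym a') exa' add1n => -[c].
have /cards1P[t tE] : #|(N a :&: N a') :\ x| == 1 by rewrite c.
have -> : pp x a a' = t.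
  by rewrite /pp tE; case: pickP => [t'|/(_ t)]; rewrite !memE ?eqxx // => /eqP.
split; last by have := set11 t; rewrite -tE !memE => /andP[].
by rewrite -tE setD1K // !memE eax e_sym.
Qed.

Lemma card_nbhd_seq y (s : seq T) (A : {set T}) : uniq s -> A =i s -> #|N y :&: A| = count (e y) s.
Proof.
move=> us As; rewrite -size_filter -(card_uniqP (filter_uniq _ us)).
by apply: eq_card => t; rewrite mem_filter !memE As.
Qed.

(** * Coordinates: Gamma_2(x) as pairs, neighbours of z as faces *)

Section Frame.
Variables (x z : T) (ns bs : seq T).
Hypothesis dxz : d x z = 4.
Hypotheses (ns_uniq : uniq ns) (nsE : forall y, (y \in ns) = e x y).
Hypotheses (bs_uniq : uniq bs) (bsE : forall y, (y \in bs) = e z y).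
Local Notation n i := (nth x ns i).
Local Notation b k := (nth z bs k).
Local Notation P i j := (pp x (n i) (n j)).

Lemma size_nbrs (s : seq T) y : uniq s -> (forall t, (t \in s) = e y t) -> size s = 5.
Proof.
by move=> us sE; rewrite -(card_uniqP us) (eq_card (B := N y)) ?regE ?mu2 // => t; rewrite memE sE.
Qed.

Let ns5 : size ns = 5. Proof. exact: size_nbrs ns_uniq nsE. Qed.
Let bs5 : size bs = 5. Proof. exact: size_nbrs bs_uniq bsE. Qed.

Lemma frame_xn i : i < 5 -> e x (n i).
Proof. by move=> i5; rewrite -nsE mem_nth ?ns5. Qed.

Lemma frame_zb k : k < 5 -> e z (b k).
Proof. by move=> k5; rewrite -bsE mem_nth ?bs5. Qed.

Lemma frame_n_eq i j : i < 5 -> j < 5 -> (n i == n j) = (i == j).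
Proof. by move=> i5 j5; rewrite nth_uniq ?ns5. Qed.

Lemma frame_b_eq i j : i < 5 -> j < 5 -> (b i == b j) = (i == j).
Proof. by move=> i5 j5; rewrite nth_uniq ?bs5. Qed.

Lemma frame_P i j : i < 5 -> j < 5 -> i != j ->
  [/\ e (n i) (P i j), e (n j) (P i j), P i j != x & d x (P i j) = 2].
Proof.
move=> i5 j5 ij; have nij : n i != n j by rewrite frame_n_eq.
have [ppI ppx] := ppE (frame_xn i5) (frame_xn j5) nij.
have : P i j \in N (n i) :&: N (n j) by rewrite ppI in_set2 eqxx orbT.
rewrite !memE => /andP[e1 e2]; split=> //.
by apply: dist_two (frame_xn i5) e1 _; rewrite eq_sym.
Qed.

Lemma frame_P_uniq i j t : i < 5 -> j < 5 -> i != j -> e (n i) t -> e (n j) t -> t != x -> t = P i j.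
Proof.
move=> i5 j5 ij e1 e2 tx; have nij : n i != n j by rewrite frame_n_eq.
have [/setP/(_ t)] := ppE (frame_xn i5) (frame_xn j5) nij.
by rewrite !memE e1 e2 (negbTE tx) /= => /esym/eqP.
Qed.

Lemma frame_P_C i j : P i j = P j i.
Proof. by rewrite /pp setIC. Qed.

Lemma frame_nP i j c : i < 5 -> j < 5 -> c < 5 -> i != j -> e (n c) (P i j) = (c == i) || (c == j).
Proof.
move=> i5 j5 c5 ij; have [e1 e2 _ dP] := frame_P i5 j5 ij.
have /eqP/setP/(_ (n c)) : [set n i; n j] == N x :&: N (P i j).
  rewrite eqEcard (muE dP) mu2 cards2 frame_n_eq // ij andbT.
  apply/subsetP=> t; rewrite !memE => /orP[]/eqP->; rewrite frame_xn // e_sym //.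
by rewrite !memE frame_xn // !frame_n_eq // e_sym => ->.
Qed.

Lemma frame_P_inj i j i' j' : i < 5 -> j < 5 -> i' < 5 -> j' < 5 -> i != j -> i' != j' ->
  P i j = P i' j' -> ((i' == i) || (i' == j)) && ((j' == i) || (j' == j)).
Proof.
move=> i5 j5 i5' j5' ij ij' eqPP; rewrite -!(@frame_nP i j) // eqPP.
by have [-> ->] := frame_P i5' j5' ij'.
Qed.

Lemma nbr_n y : e x y -> exists2 i, i < 5 & y = n i.
Proof. by rewrite -nsE => /(nthP x)[i]; rewrite ns5 => i5 <-; exists i. Qed.

Lemma nbr_b y : e z y -> exists2 k, k < 5 & y = b k.
Proof. by rewrite -bsE => /(nthP z)[k]; rewrite bs5 => k5 <-; exists k. Qed.

Lemma dist2_P y : d x y = 2 -> exists i j, [/\ i < 5, j < 5, i != j & y = P i j].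
Proof.
move=> dxy; have : 1 < #|N x :&: N y| by rewrite (muE dxy) mu2.
case/card_gt1P=> a [a' [+ + aa']]; rewrite !memE => /andP[/nbr_n[i i5 ai] eya] /andP[/nbr_n[j j5 aj] eya'].
move: eya' eya aa'; rewrite ai aj !(e_sym y) => e1 e2 nij.
have ij : i != j by apply: contraNneq nij => ->.
exists i, j; split=> //; apply: frame_P_uniq => //.
by apply/eqP=> yx; rewrite yx distxx in dxy.
Qed.

Lemma nbrs_n i : i < 5 -> let s := x :: [seq P i j | j <- rem i (iota 0 5)] in
  uniq s /\ (forall y, e (n i) y = (y \in s)).
Proof.
move=> i5 s; have memr j : (j \in rem i (iota 0 5)) = (j != i) && (j < 5).
  by rewrite mem_rem_uniq ?iota_uniq // inE mem_iota.
have us : uniq s.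
  rewrite /s cons_uniq; apply/andP; split.
    apply/mapP=> -[j]; rewrite memr eq_sym => /andP[ij j5] /esym/eqP.
    by have [_ _ /negbTE-> _] := frame_P i5 j5 ij.
  rewrite map_inj_in_uniq ?rem_uniq ?iota_uniq // => j j'.
  rewrite !memr => /andP[ji j5] /andP[ji' j5'] eqPP.
  have [ij ij'] : i != j /\ i != j' by rewrite ![i == _]eq_sym.
  by have := frame_P_inj i5 j5 i5 j5' ij ij' eqPP; rewrite (negbTE ji') => /andP[_ /eqP].
split=> //; apply: nbr_five => //.
  have : size (rem i (iota 0 5)) = 4 by rewrite size_rem ?mem_iota.
  by rewrite -(size_map (fun j => P i j)) => s4; rewrite -s4.
rewrite /s [all _ _]andbC -[X in _ && X]/(e (n i) x) e_sym frame_xn // andbT; apply/allP=> _ /mapP[j jr ->].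
by move: jr; rewrite memr eq_sym => /andP[ij j5]; have [] := frame_P i5 j5 ij.
Qed.

Definition frame_row y := [seq e y (P q.1 q.2) | q <- pairs5].

Lemma entry_row y i j : i < 5 -> j < 5 -> i != j -> entry (frame_row y) i j = e y (P i j).
Proof.
by case: i => [|[|[|[|[|//]]]]]; case: j => [|[|[|[|[|//]]]]] // _ _ _;
  rewrite /entry /=; first [done | by rewrite [in RHS]frame_P_C].
Qed.

Lemma P_list : let s := [seq P q.1 q.2 | q <- pairs5] in uniq s /\ sphere e 2 x =i s.
Proof.
have okp q : q \in pairs5 -> [/\ q.1 < 5, q.2 < 5 & q.1 < q.2].
  by have/allP/(_ q) : all (fun q => [&& q.1 < 5, q.2 < 5 & q.1 < q.2]) pairs5 by [];
    move=> H /H/and3P.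
move=> s; have us : uniq s.
  rewrite map_inj_in_uniq // => q q' qp qp' eqPP.
  have [q1 q2 q12] := okp q qp; have [q1' q2' q12'] := okp q' qp'.
  have := frame_P_inj q1 q2 q1' q2' _ _ eqPP; rewrite !neq_ltn q12 q12' => /(_ isT isT).
  case: q q' {eqPP qp qp'} q1 q2 q12 q1' q2' q12' => q1 q2 [q1' q2'] /=.
  by move=> _ _ lt _ _ lt' H; have [-> ->] : q1 = q1' /\ q2 = q2' by clear -lt lt' H; lia.
split=> //; have /setP sE : [set t in s] = sphere e 2 x.
  apply/eqP; rewrite eqEcard card_sphere2 mu2 cardsE (card_uniqP us) size_map andbT.
  apply/subsetP=> t; rewrite inE => /mapP[q /okp[q1 q2 q12] ->]; rewrite memE.
  have qne : q.1 != q.2 by rewrite neq_ltn q12.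
  by have [_ _ _ ->] := frame_P q1 q2 qne.
by move=> t; rewrite -sE inE.
Qed.

Lemma card_row y : #|N y :&: sphere e 2 x| = count id (frame_row y).
Proof. by have [us sE] := P_list; rewrite (card_nbhd_seq y us sE) !count_map. Qed.

Lemma common_02 y y' : y != y' -> #|N y :&: N y'| \in [:: 0; 2].
Proof.
move=> yy'; case: (posnP #|N y :&: N y'|) => [->//|/card_gt0P[t]].
rewrite !memE (e_sym y') => /andP[e1 e2].
by rewrite (card_common2 e1 e2 yy').
Qed.

(** The degree of the face [y] at a point counts the common neighbours of [y] and that neighbour of
    [x], hence is 0 or 2. *)
Lemma row_ok_row y : e z y -> row_ok (frame_row y).
Proof.
move=> ezy.
have exy : e x y = false.
  by apply/negP=> exy; have := dist_path2 exy (_ : e y z); rewrite dxz e_sym => /(_ ezy).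
apply/andP; split; last first.
  have : #|N y :\ z| = 4 by have := regE y; rewrite (cardsD1 z) memE e_sym ezy mu2 => -[].
  rewrite -card_row => <-; apply/subset_leq_card/subsetP=> t; rewrite !memE => /andP[-> /eqP dt].
  by rewrite andbT; apply/eqP=> tz; move: dt; rewrite tz dxz.
apply/allP=> i; rewrite mem_iota add0n /= => i5.
have [us sE] := nbrs_n i5.
have yn : y != n i by apply/eqP=> yn; rewrite yn frame_xn in exy.
have := common_02 yn; rewrite (card_nbhd_seq y us); last by move=> t; rewrite memE sE.
have cons0 s : count (e y) (x :: s) = count (e y) s by rewrite /= e_sym exy.
rewrite cons0 count_map.
suff /eq_in_count-> : {in rem i (iota 0 5), preim (fun j => P i j) (e y) =1 entry (frame_row y) i} by [].
move=> j; rewrite mem_rem_uniq ?iota_uniq // inE mem_iota eq_sym => /andP[ij j5].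
by rewrite entry_row.
Qed.

Lemma overlap_row y y' : overlap (frame_row y) (frame_row y') = #|N y :&: N y' :&: sphere e 2 x|.
Proof.
have [us sE] := P_list; rewrite -setIA.
have -> : #|N y :&: (N y' :&: sphere e 2 x)| = count (fun t => e y t && e y' t) [seq P q.1 q.2 | q <- pairs5].
  rewrite -size_filter -(card_uniqP (filter_uniq _ us)); apply: eq_card => t.
  by rewrite mem_filter -sE !memE andbA.
by rewrite count_map.
Qed.

Lemma overlap_row_le y y' : e z y -> e z y' -> y != y' -> overlap (frame_row y) (frame_row y') <= 1.
Proof.
move=> ezy ezy' yy'; rewrite overlap_row; have eyz : e y z by rewrite e_sym.
have := card_common2 eyz ezy' yy'; rewrite (cardsD1 z) !memE eyz e_sym ezy' add1n => -[c].
apply: (@leq_trans #|(N y :&: N y') :\ z|); last by rewrite c.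
apply/subset_leq_card/subsetP=> t; rewrite !memE => /andP[-> /eqP dt]; rewrite andbT.
by apply/eqP=> tz; move: dt; rewrite tz dxz.
Qed.

Lemma column_row c : c < 10 -> let q := nth (0, 0) pairs5 c in
  column [seq frame_row y | y <- bs] c = #|N (P q.1 q.2) :&: N z|.
Proof.
move=> c10 q; rewrite (card_nbhd_seq _ bs_uniq); last by move=> t; rewrite memE bsE.
rewrite /column count_map; apply: eq_count => y /=.
by rewrite (nth_map (0, 0)) // e_sym.
Qed.

Definition tab (rws : seq (seq bool)) k (q : nat * nat) := entry (nth [::] rws k) q.1 q.2.
Definition pair_ok (q : nat * nat) := [&& q.1 < 5, q.2 < 5 & q.1 != q.2].
Definition in_pair c (q : nat * nat) := (c == q.1) || (c == q.2).
(** For proper pairs this is inequality as unordered pairs, since [P] is symmetric. *)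
Definition pair_ne (q q' : nat * nat) := ~~ (in_pair q'.1 q && in_pair q'.2 q).
Definition faced rws q := has (fun k => tab rws k q) (iota 0 5).
Definition known_common_n q q' := count (fun c => in_pair c q && in_pair c q') (iota 0 5).
Definition known_common rws q q' :=
  known_common_n q q' + count (fun k => tab rws k q && tab rws k q') (iota 0 5).
Definition triangular rws k := count (tab rws k) pairs5 == 3.

Local Notation Q q := (P q.1 q.2).

Lemma nonadj_xb k : k < 5 -> e x (b k) = false.
Proof.
move=> k5; apply/negP=> exb; have := dist_path2 exb (_ : e (b k) z).
by rewrite dxz e_sym frame_zb // => /(_ isT).
Qed.

Lemma frame_nQ c q : c < 5 -> pair_ok q -> e (n c) (Q q) = in_pair c q.
Proof. by move=> c5 /and3P[q1 q2 q12]; rewrite frame_nP. Qed.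

Lemma dist_Q q : pair_ok q -> d x (Q q) = 2.
Proof. by case/and3P=> q1 q2 q12; have [] := frame_P q1 q2 q12. Qed.

Lemma Q_ne q q' : pair_ok q -> pair_ok q' -> pair_ne q q' -> Q q != Q q'.
Proof.
move=> /and3P[q1 q2 q12] /and3P[q1' q2' q12'] ne; apply/eqP=> eqQ.
by move: ne; rewrite /pair_ne (frame_P_inj q1 q2 q1' q2' q12 q12' eqQ).
Qed.

Lemma card_common_n q q' : pair_ok q -> pair_ok q' ->
  #|N (Q q) :&: N (Q q') :&: N x| = known_common_n q q'.
Proof.
move=> okq okq'; have nsI : N x =i ns by move=> t; rewrite memE nsE.
transitivity (count (fun t => e t (Q q) && e t (Q q')) ns).
  rewrite -size_filter -(card_uniqP (filter_uniq _ ns_uniq)); apply: eq_card => t.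
  by rewrite mem_filter -nsI !memE !(e_sym t).
rewrite -[X in count _ X](mkseq_nth x) ns5 /mkseq count_map; apply: eq_in_count => c.
by rewrite mem_iota => /andP[_ c5] /=; rewrite !frame_nQ.
Qed.

Lemma nb_ne i k : i < 5 -> k < 5 -> n i != b k.
Proof. by move=> i5 k5; apply/eqP=> nb; have := nonadj_xb k5; rewrite -nb frame_xn. Qed.

Section Rows.
Variable rws : seq (seq bool).
Hypothesis rwsE : [seq frame_row y | y <- bs] = rws.
Local Notation I := (N x :|: N z).
Local Notation w q := (rest x z (Q q)).
Local Notation u k := (fifth x z (b k)).

Lemma frame_bP k q : k < 5 -> pair_ok q -> e (b k) (Q q) = tab rws k q.
Proof.
move=> k5 /and3P[q1 q2 q12]; rewrite /tab -rwsE (nth_map z) ?bs5 //.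
by rewrite entry_row.
Qed.

Lemma faced_dist q : pair_ok q -> faced rws q -> d z (Q q) = 2.
Proof.
move=> okq /hasP[k]; rewrite mem_iota => /andP[_ k5]; rewrite -frame_bP //.
by apply: (@dist_mid_z x z dxz); rewrite ?dist_Q ?frame_zb.
Qed.

Lemma unfaced_dist q : pair_ok q -> ~~ faced rws q -> d z (Q q) <> 2.
Proof.
move=> okq /hasPn nf dz2; have [y dy eyQ] := dist_pred dz2.
have [k k5 yk] : exists2 k, k < 5 & y = b k by apply: nbr_b; rewrite -dist1 dy.
by have := nf k; rewrite mem_iota -frame_bP // -yk eyQ => /(_ k5).
Qed.

Lemma card_common_I q q' : pair_ok q -> pair_ok q' ->
  #|N (Q q) :&: N (Q q') :&: I| = known_common rws q q'.
Proof.
move=> okq okq'; rewrite setIUr cardsU card_common_n //.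
have -> : #|N (Q q) :&: N (Q q') :&: N x :&: (N (Q q) :&: N (Q q') :&: N z)| = 0.
  apply/eqP; rewrite cards_eq0 -subset0 -(diametral_nbr_disj dxz (Q q)).
  by apply/subsetP=> t; rewrite !memE => /andP[/andP[/andP[-> _] ->] /andP[_ ->]].
rewrite subn0; congr (_ + _); have bsI : N z =i bs by move=> t; rewrite memE bsE.
transitivity (count (fun t => e t (Q q) && e t (Q q')) bs).
  rewrite -size_filter -(card_uniqP (filter_uniq _ bs_uniq)); apply: eq_card => t.
  by rewrite mem_filter -bsI !memE !(e_sym t).
rewrite -[X in count _ X](mkseq_nth z) bs5 /mkseq count_map; apply: eq_in_count => k.
by rewrite mem_iota => /andP[_ k5] /=; rewrite !frame_bP.
Qed.

(** Here and in the next lemmas the premises form one boolean in the table [rws], so that on a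
    concrete table they hold by evaluation. *)
Lemma w_eq q q' :
  [&& pair_ok q, pair_ok q', pair_ne q q', faced rws q, faced rws q' & known_common rws q q' == 1] ->
  w q = w q'.
Proof.
case/and5P=> okq okq' ne fq /andP[fq' /eqP c1].
by apply: rest_eq; rewrite ?card_common_I ?faced_dist ?dist_Q ?Q_ne.
Qed.

Lemma w_ne q q' :
  [&& pair_ok q, pair_ok q', pair_ne q q', faced rws q, faced rws q' & known_common rws q q' == 2] ->
  w q != w q'.
Proof.
case/and5P=> okq okq' ne fq /andP[fq' /eqP c2]; apply/eqP.
by apply: rest_ne; rewrite ?card_common_I ?faced_dist ?dist_Q ?Q_ne.
Qed.

Lemma w_far q q' :
  [&& pair_ok q, pair_ok q', pair_ne q q', faced rws q, ~~ faced rws q' & known_common_n q q' == 1] ->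
  e (w q) (Q q').
Proof.
case/and5P=> okq okq' ne fq /andP[fq' /eqP c2].
by apply: rest_adj_far (unfaced_dist okq' fq') _ _; rewrite ?card_common_n ?faced_dist ?dist_Q ?Q_ne.
Qed.

Lemma w_P q : pair_ok q && faced rws q -> [/\ e (Q q) (w q), ~~ e x (w q) & ~~ e z (w q)].
Proof. by case/andP=> okq fq; apply: restP; rewrite ?dist_Q ?faced_dist. Qed.

Lemma card_face k : k < 5 -> #|N (b k) :&: sphere e 2 x| = count (tab rws k) pairs5.
Proof.
move=> k5; have [us sE] := P_list; rewrite (card_nbhd_seq _ us sE) count_map.
apply: eq_in_count => q qp /=; rewrite frame_bP //.
by move: q qp; apply/allP.
Qed.

Lemma face_mem k y : k < 5 -> d x y = 2 -> e (b k) y -> exists q, [/\ q \in pairs5, tab rws k q & y = Q q].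
Proof.
move=> k5 dy eby; have [_ /(_ y)] := P_list; rewrite memE dy => /esym/mapP[q qp yq].
exists q; split=> //; rewrite -frame_bP -?yq //.
by move: q qp {yq}; apply/allP.
Qed.

Lemma w_u q k : [&& k < 5, pair_ok q, tab rws k q, triangular rws k &
   all (fun q' => tab rws k q' ==> (q' == q) ||
     [&& pair_ne q' q, faced rws q' & known_common rws q' q == 2]) pairs5] ->
  e (w q) (u k).
Proof.
case/and5P=> k5 okq tq /eqP tri /allP H; apply: rest_adj_fifth => //.
- by rewrite dist_Q.
- exact: frame_zb.
- by rewrite frame_bP.
- by rewrite card_face.
move=> m' dm' ebm' mm'; have [q' [q'p tq' mq']] := face_mem k5 dm' ebm'.
have okq' : pair_ok q' by move: q' q'p {tq' mq'}; apply/allP.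
have := H q' q'p; rewrite tq' /= => /orP[/eqP qq|/and3P[ne fq' c2]].
  by rewrite mq' qq eqxx in mm'.
apply/eqP; rewrite mq'; apply: w_ne; rewrite okq okq' ne fq' c2 andbT /=.
by apply/hasP; exists k; rewrite // mem_iota.
Qed.

Lemma u_eq k k' : [&& k < 5, k' < 5, k != k', triangular rws k, triangular rws k' &
   all (fun q => ~~ (tab rws k q && tab rws k' q)) pairs5] -> u k = u k'.
Proof.
case/and5P=> k5 k5' kk' /eqP tk /andP[/eqP tk' /allP H].
apply: fifth_eq => //; rewrite ?card_face ?frame_zb ?frame_b_eq //.
apply/setP=> y; rewrite !memE; apply/negP=> /andP[/andP[ey ey'] /eqP dy].
have [q [qp tq yq]] := face_mem k5 dy ey.
have := H q qp; rewrite tq -frame_bP -?yq ?ey' //.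
by move: q qp {tq yq}; apply/allP.
Qed.

Lemma u_ne k k' q : [&& k < 5, k' < 5, k != k', triangular rws k, triangular rws k',
   pair_ok q & tab rws k q && tab rws k' q] -> u k != u k'.
Proof.
case/and5P=> k5 k5' kk' /eqP tk /and3P[/eqP tk' okq /andP[tq tq']]; apply/eqP.
by apply: (@fifth_ne x z dxz (b k) (b k') (Q q));
  rewrite ?card_face ?frame_zb ?frame_b_eq ?dist_Q ?frame_bP.
Qed.

Lemma u_P k : (k < 5) && triangular rws k -> [/\ e (b k) (u k), u k != z & d x (u k) <> 2].
Proof. by case/andP=> k5 /eqP tk; apply: fifthP; rewrite ?card_face ?frame_zb. Qed.

Lemma nbrs_faced q k k' : [&& pair_ok q, k < 5, k' < 5, k != k', tab rws k q & tab rws k' q] ->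
  uniq [:: n q.1; n q.2; b k; b k'; w q] /\
  forall y, e (Q q) y = (y \in [:: n q.1; n q.2; b k; b k'; w q]).
Proof.
case/and5P=> okq k5 k5' kk' /andP[tq tq'].
have fq : faced rws q by apply/hasP; exists k; rewrite // mem_iota.
have [q1 q2 q12] := and3P okq; have [e1 xw zw] := w_P (introT andP (conj okq fq)).
have us : uniq [:: n q.1; n q.2; b k; b k'; w q].
  have nw i : i < 5 -> n i != w q by move=> i5; apply/eqP=> nwE; rewrite -nwE frame_xn in xw.
  have bw i : i < 5 -> b i != w q by move=> i5; apply/eqP=> bwE; rewrite -bwE frame_zb in zw.
  by rewrite /= !inE !negb_or !nw // !bw // !nb_ne // frame_n_eq // frame_b_eq // q12 kk'.
split=> //; apply: nbr_five => //; rewrite /= e1 !(e_sym (Q q)) !frame_nQ // !frame_bP // tq tq'.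
by rewrite /in_pair !eqxx orbT.
Qed.

End Rows.

Lemma b_dist_ge3 y : e z y -> 3 <= d x y.
Proof. by move/(dist_edge2 x); rewrite dxz => /andP[_]. Qed.

Definition all_pairs := [seq (i, j) | i <- iota 0 5, j <- iota 0 5].

(* If this vertex were at distance 2 from [x], it would be the pair [r], the only one disjoint from
   [q], [s1] and [s2]; but [r] has a single neighbour outside [N x] and [N z]. *)
Lemma w_dist_ne2 rws q s1 s2 r f1 f2 : [seq frame_row y | y <- bs] = rws ->
  [&& pair_ok q, faced rws q & all (fun s => [&& pair_ok s, pair_ne q s, ~~ faced rws s &
     known_common_n q s == 1]) [:: s1; s2]] ->
  [&& pair_ok r, f1 < 5, f2 < 5, f1 != f2, tab rws f1 r & tab rws f2 r] ->
  all (fun r' => pair_ok r' ==> [|| known_common_n q r' != 0, known_common_n s1 r' != 0,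
    known_common_n s2 r' != 0 | ~~ pair_ne r r']) all_pairs ->
  d x (rest x z (P q.1 q.2)) <> 2.
Proof.
move=> rwsE /and3P[okq fq] /and3P[/and4P[ok1 ne1 nf1 c1] /and4P[ok2 ne2 nf2 c2] _] facer /allP H dw.
have [e0 xw zw] := w_P rwsE (introT andP (conj okq fq)).
have e1 : e (rest x z (P q.1 q.2)) (P s1.1 s1.2) by apply: (w_far rwsE); rewrite okq ok1 ne1 fq nf1.
have e2 : e (rest x z (P q.1 q.2)) (P s2.1 s2.2) by apply: (w_far rwsE); rewrite okq ok2 ne2 fq nf2.
have [r1 [r2 [r15 r25 r12 wr]]] := dist2_P dw.
have okr' : pair_ok (r1, r2) by apply/and3P.
have disj s : pair_ok s -> e (rest x z (P q.1 q.2)) (P s.1 s.2) -> known_common_n s (r1, r2) = 0.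
  move=> oks ews; apply/eqP; rewrite -leqn0 leqNgt -has_count; apply/hasPn=> c.
  rewrite mem_iota => /andP[_ c5]; apply/negP=> /andP[cs cr].
  have ecs : e (n c) (P s.1 s.2) by rewrite frame_nQ.
  have ecr : e (n c) (P r1 r2) by rewrite (frame_nQ c5 okr').
  by have := no_triangle ecs (_ : e _ (P r1 r2)); rewrite ecr -wr e_sym => /(_ ews).
have := H (r1, r2); rewrite okr' (disj q) 1?e_sym // (disj s1) // (disj s2) //= negbK.
have -> : (r1, r2) \in all_pairs by apply/allpairsP; exists (r1, r2); rewrite !mem_iota.
move=> /(_ isT) /andP[in1 in2].
have [us rE] := nbrs_faced rwsE facer.
have [okr f15 /andP[f25 _]] := and3P facer.
have [r15' r25' r12'] := and3P okr; have [_ _ Px dr] := frame_P r15' r25' r12'.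
have Qr : P r.1 r.2 = P r1 r2 by apply: frame_P_uniq; rewrite ?frame_nQ.
have wE t : d x t = 2 -> e (P r.1 r.2) t -> t = rest x z (P r.1 r.2).
  move=> dt; rewrite rE !inE => /or4P[/eqP tE|/eqP tE|/eqP tE|/orP[]/eqP tE]; last by [].
  - by have := dist1 x t; rewrite {2}tE frame_xn // dt.
  - by have := dist1 x t; rewrite {2}tE frame_xn // dt.
  - by have := b_dist_ge3 (frame_zb f15); rewrite -tE dt.
  - by have := b_dist_ge3 (frame_zb f25); rewrite -tE dt.
have rq : e (P r.1 r.2) (P q.1 q.2) by rewrite Qr -wr e_sym.
have rs : e (P r.1 r.2) (P s1.1 s1.2) by rewrite Qr -wr.
have := Q_ne okq ok1 ne1.
by rewrite {1}(wE _ (dist_Q okq) rq) -(wE _ (dist_Q ok1) rs) eqxx.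
Qed.

(* The fifth neighbour of z lies on no face, so it is at distance 4 from x; but all
   vertices at distance at most 2 from it are at distance at least 3 from x. *)
Lemma tetra_absurd : [seq frame_row y | y <- bs] = tetra_rows -> False.
Proof.
move=> rwsE; have zb4 : e z (b 4) by rewrite frame_zb.
have b4_far t : d x t = 2 -> e (b 4) t = false.
  move=> dt; apply/negP=> ebt; have [q [qp tq _]] := face_mem rwsE (isT : 4 < 5) dt ebt.
  have /allP/(_ q qp) : all (fun q => ~~ tab tetra_rows 4 q) pairs5 by [].
  by rewrite tq.
have dxb4 : d x (b 4) = 4.
  have := b_dist_ge3 zb4; have := dist_le4 x (b 4).
  suff : d x (b 4) <> 3 by lia.
  by case/dist_pred=> m dm emb; have := b4_far m dm; rewrite e_sym emb.
have [m [dm dmb]] := diametral_mid_ex dxb4.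
have [c dmc ecb] := dist_pred dmb; have emc : e m c by rewrite -dist1 dmc.
have ebc : e (b 4) c by rewrite e_sym.
have cz : c != z.
  apply/eqP=> cz; move: emc; rewrite cz => /(dist_edge2 x); rewrite dm dxz; lia.
have dc : d x c <> 2 by move/b4_far; rewrite ebc.
have zc : z != c by rewrite eq_sym.
(* [z] and [c] share [b 4], hence also some triangular face [b k], and [c] must be the fifth
   neighbour of that face. *)
have := card_common2 zb4 ebc zc; rewrite (cardsD1 (b 4)) !memE zb4 ecb add1n => -[c1].
have /card_gt0P[y] : 0 < #|(N z :&: N c) :\ b 4| by rewrite c1.
rewrite !memE => /and3P[yb4 /nbr_b[k k5 yk] ecy].
have k4 : k < 4 by rewrite ltn_neqAle -ltnS k5 andbT; apply: contraNneq yb4 => k4; rewrite yk k4.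
have tri : triangular tetra_rows k by case: k k4 {k5 yk} => [|[|[|[|//]]]].
have cu : c = fifth x z (b k).
  apply: fifth_uniq => //; [exact: frame_zb | by rewrite (card_face rwsE k5); apply/eqP | by rewrite -yk e_sym].
pose w q := rest x z (P q.1 q.2).
(* The five neighbours of [c] are then [b 4], [b k] and the [w] of the three edges of face [k]. None
   is at distance 2 from [x], but the neighbour [m] of [c] is. *)
have fin q1 q2 q3 : [/\ e (w q1) c, e (w q2) c & e (w q3) c] ->
    [/\ w q1 != w q2, w q1 != w q3 & w q2 != w q3] ->
    [/\ d x (w q1) <> 2, d x (w q2) <> 2 & d x (w q3) <> 2] ->
    all (fun q => pair_ok q && faced tetra_rows q) [:: q1; q2; q3] -> False.
  move=> [e1 e2 e3] [n12 n13 n23] [d1 d2 d3] /and4P[f1 f2 f3 _].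
  have bw i q : i < 5 -> pair_ok q && faced tetra_rows q -> b i != w q.
    move=> i5 fq; have [_ _ zw] := w_P rwsE fq.
    by apply/eqP=> bwE; case/negP: zw; rewrite -[rest _ _ _]bwE frame_zb.
  have := nbr_five (a := c) (s := [:: b 4; b k; w q1; w q2; w q3]).
  have b4k : b 4 != b k by rewrite -yk eq_sym.
  rewrite /= !inE !negb_or !bw // n12 n13 n23 b4k /= ecb !(e_sym c) e1 e2 e3 -yk e_sym ecy.
  move=> /(_ isT erefl isT m); rewrite (e_sym c) emc !inE => /esym/or4P[/eqP mE|/eqP mE|/eqP mE|/orP[]/eqP mE].
  - by have := dxb4; rewrite -mE dm.
  - by have := b_dist_ge3 (frame_zb k5); rewrite -yk -mE dm.
  - by case: d1; rewrite -mE.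
  - by case: d2; rewrite -mE.
  - by case: d3; rewrite -mE.
have wd q s1 s2 r f1 f2 := @w_dist_ne2 tetra_rows q s1 s2 r f1 f2 rwsE.
(* For each edge of the tetrahedron: the two pairs joining its ends to the uncovered point 4, the
   opposite edge, and the two faces on that edge. *)
have d01 := wd (0, 1) (0, 4) (1, 4) (2, 3) 0 1 isT isT isT.
have d02 := wd (0, 2) (0, 4) (2, 4) (1, 3) 0 2 isT isT isT.
have d03 := wd (0, 3) (0, 4) (3, 4) (1, 2) 0 3 isT isT isT.
have d12 := wd (1, 2) (1, 4) (2, 4) (0, 3) 1 2 isT isT isT.
have d13 := wd (1, 3) (1, 4) (3, 4) (0, 2) 1 3 isT isT isT.
have d23 := wd (2, 3) (2, 4) (3, 4) (0, 1) 2 3 isT isT isT.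
have wn q q' := @w_ne tetra_rows rwsE q q'.
have wu q := @w_u tetra_rows rwsE q k.
rewrite -cu in wu.
case: k k4 wu {k5 yk tri cu fin} (fin) => [|[|[|[|//]]]] _ wu fin.
- by apply: (fin (1, 2) (1, 3) (2, 3)) => //; split; first [exact: wu | exact: wn].
- by apply: (fin (0, 2) (0, 3) (2, 3)) => //; split; first [exact: wu | exact: wn].
- by apply: (fin (0, 1) (0, 3) (1, 3)) => //; split; first [exact: wu | exact: wn].
- by apply: (fin (0, 1) (0, 2) (1, 2)) => //; split; first [exact: wu | exact: wn].
Qed.

(** * The square pyramid determines the graph *)

Section Pyramid.
Hypothesis rwsE : [seq frame_row y | y <- bs] = pyramid_rows.
Local Notation w i j := (rest x z (P i j)).
Local Notation u k := (fifth x z (b k)).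

(** In the order of [pyramid_adj]. The eight [w] of the pyramid edges coincide in pairs, as do the
    four [u] of the triangles; one representative of each is listed. *)
Definition pyramid_vertices :=
  [:: x; n 0; n 1; n 2; n 3; n 4;
      P 0 1; P 0 2; P 0 3; P 0 4; P 1 2; P 1 3; P 1 4; P 2 3; P 2 4; P 3 4;
      b 0; b 1; b 2; b 3; b 4; z; w 0 1; w 0 2; w 1 2; w 2 3; u 1; u 2].

Lemma P_ne i j i' j' : [&& pair_ok (i, j), pair_ok (i', j') & pair_ne (i, j) (i', j')] ->
  P i j != P i' j'.
Proof. by case/and3P=> ok ok' ne; apply: (Q_ne ok ok' ne). Qed.

Lemma P_nz i j : pair_ok (i, j) -> P i j != z.
Proof. by move/dist_Q=> dP; apply/eqP=> Pz; move: dP; rewrite /= Pz dxz. Qed.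

Lemma P_nx i j : pair_ok (i, j) -> x != P i j.
Proof. by move/dist_Q=> dP; apply/eqP=> Px; move: dP; rewrite /= -Px distxx. Qed.

Lemma P_nu i j k : pair_ok (i, j) && ((k < 5) && triangular pyramid_rows k) -> P i j != u k.
Proof.
case/andP=> /dist_Q dP /(u_P rwsE)[_ _ du].
by apply/eqP=> Pu; apply: du; rewrite -Pu.
Qed.

Lemma n_nw c i j : (c < 5) && (pair_ok (i, j) && faced pyramid_rows (i, j)) -> n c != w i j.
Proof.
case/andP=> c5 /(w_P rwsE)[_ /negP xw _]; apply/eqP=> nw.
by case: xw; rewrite [rest _ _ _](esym nw) frame_xn.
Qed.

Lemma b_nw k i j : (k < 5) && (pair_ok (i, j) && faced pyramid_rows (i, j)) -> b k != w i j.
Proof.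
case/andP=> k5 /(w_P rwsE)[_ _ /negP zw]; apply/eqP=> bw.
by case: zw; rewrite [rest _ _ _](esym bw) frame_zb.
Qed.

Lemma e_nP c i j : [&& c < 5, pair_ok (i, j) & in_pair c (i, j)] -> e (n c) (P i j).
Proof. by case/and3P=> c5 ok cij; rewrite (frame_nQ c5 ok). Qed.

Lemma e_bP k i j : [&& k < 5, pair_ok (i, j) & tab pyramid_rows k (i, j)] -> e (b k) (P i j).
Proof. by case/and3P=> k5 ok kij; rewrite (frame_bP rwsE k5 ok). Qed.

Lemma pyramid_local i : i < 28 ->
  uniq [seq nth x pyramid_vertices j | j <- nth [::] pyramid_adj i] &&
  all (e (nth x pyramid_vertices i)) [seq nth x pyramid_vertices j | j <- nth [::] pyramid_adj i].
Proof.
have weq i1 j1 i2 j2 := @w_eq pyramid_rows rwsE (i1, j1) (i2, j2).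
have wne i1 j1 i2 j2 := @w_ne pyramid_rows rwsE (i1, j1) (i2, j2).
have wP i1 j1 : pair_ok (i1, j1) && faced pyramid_rows (i1, j1) -> e (P i1 j1) (w i1 j1) by move=> H; have [] := @w_P pyramid_rows rwsE (i1, j1) H.
have wfar i1 j1 i2 j2 := @w_far pyramid_rows rwsE (i1, j1) (i2, j2).
have wu i1 j1 k := @w_u pyramid_rows rwsE (i1, j1) k.
(* Opposite lateral edges share only the apex 0, opposite base edges only the face [b 0]; opposite
   triangles share no edge. *)
have w03 : w 0 3 = w 0 1 := weq 0 3 0 1 isT.
have w04 : w 0 4 = w 0 2 := weq 0 4 0 2 isT.
have w34 : w 3 4 = w 1 2 := weq 3 4 1 2 isT.
have w14 : w 1 4 = w 2 3 := weq 1 4 2 3 isT.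
have u3 : u 3 = u 1 := @u_eq pyramid_rows rwsE 3 1 isT.
have u4 : u 4 = u 2 := @u_eq pyramid_rows rwsE 4 2 isT.
have u12 : u 1 != u 2 := @u_ne pyramid_rows rwsE 1 2 (0, 2) isT.
have bu k : (k < 5) && triangular pyramid_rows k -> e (b k) (u k) by move=> H; have [] := @u_P pyramid_rows rwsE k H.
have uz k : (k < 5) && triangular pyramid_rows k -> z != u k by rewrite eq_sym => H; have [] := @u_P pyramid_rows rwsE k H.
have wn12_01 : w 0 1 != w 1 2 := wne 0 1 1 2 isT.
have wn02_01 : w 0 1 != w 0 2 := wne 0 1 0 2 isT.
(* The pairs (0, 1) and (2, 3) share neither a point nor a face; (0, 3) and (2, 3) share one of
   each. *)
have wn23_01 : w 0 1 != w 2 3 by rewrite -w03; apply: (wne 0 3 2 3 isT).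
have wn12_02 : w 0 2 != w 1 2 := wne 0 2 1 2 isT.
have wn23_02 : w 0 2 != w 2 3 := wne 0 2 2 3 isT.
have wn23_12 : w 1 2 != w 2 3 := wne 1 2 2 3 isT.
have a01 : e (P 0 1) (w 0 1) := wP 0 1 isT.
have a03 : e (P 0 3) (w 0 1) by rewrite -w03; exact: wP.
have a02 : e (P 0 2) (w 0 2) := wP 0 2 isT.
have a04 : e (P 0 4) (w 0 2) by rewrite -w04; exact: wP.
have a12 : e (P 1 2) (w 1 2) := wP 1 2 isT.
have a34 : e (P 3 4) (w 1 2) by rewrite -w34; exact: wP.
have a23 : e (P 2 3) (w 2 3) := wP 2 3 isT.
have a14 : e (P 1 4) (w 2 3) by rewrite -w14; exact: wP.
have f1 : e (w 0 1) (P 1 3) := wfar 0 1 1 3 isT.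
have f2 : e (w 0 2) (P 2 4) := wfar 0 2 2 4 isT.
have f3 : e (w 1 2) (P 1 3) := wfar 1 2 1 3 isT.
have f4 : e (w 1 2) (P 2 4) := wfar 1 2 2 4 isT.
have f5 : e (w 2 3) (P 1 3) := wfar 2 3 1 3 isT.
have f6 : e (w 2 3) (P 2 4) := wfar 2 3 2 4 isT.
have g1 : e (b 1) (u 1) := bu 1 isT.
have g2 : e (b 2) (u 2) := bu 2 isT.
have g3 : e (b 3) (u 1) by rewrite -u3; exact: bu.
have g4 : e (b 4) (u 2) by rewrite -u4; exact: bu.
have h1 : e (w 0 1) (u 1) := wu 0 1 1 isT.
have h2 : e (w 0 1) (u 2) by rewrite -u4; exact: (wu 0 1 4 isT).
have h3 : e (w 0 2) (u 1) := wu 0 2 1 isT.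
have h4 : e (w 0 2) (u 2) := wu 0 2 2 isT.
have h5 : e (w 1 2) (u 1) := wu 1 2 1 isT.
have h6 : e (w 2 3) (u 2) := wu 2 3 2 isT.
have edges : all (fun k => all (e (nth x pyramid_vertices k))
    [seq nth x pyramid_vertices j | j <- nth [::] pyramid_adj k]) (iota 0 28).
  by rewrite /=; repeat match goal with |- is_true (_ && _) => apply/andP; split end;
  first [exact: isT | assumption | exact: frame_xn | exact: frame_zb | exact: e_nP | exact: e_bP
    | rewrite e_sym; first [assumption | exact: frame_xn | exact: frame_zb | exact: e_nP | exact: e_bP]].
have uniqs : all (fun k => pairwise (fun y t => y != t)
    [seq nth x pyramid_vertices j | j <- nth [::] pyramid_adj k]) (iota 0 28).
  by rewrite /=; repeat match goal with |- is_true (_ && _) => apply/andP; split end;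
  first [exact: isT | assumption | exact: P_ne | exact: P_nz | exact: P_nx | exact: P_nu | exact: n_nw | exact: b_nw
    | exact: nb_ne | exact: uz | by rewrite frame_n_eq | by rewrite frame_b_eq].
by move=> i28; rewrite uniq_pairwise; apply/andP; split; [apply: (allP uniqs) | apply: (allP edges)]; rewrite mem_iota.
Qed.

(** The only global distinctness statement that the covering argument requires. *)
Lemma pyramid_fibre i : i < 28 -> nth x pyramid_vertices i = x -> i = 0.
Proof.
have xn c : c < 5 -> x != n c by move=> /frame_xn exn; apply/eqP=> xn; rewrite -xn e_irr in exn.
have xb k : k < 5 -> x != b k.
  by move=> /frame_zb/b_dist_ge3; apply: contraTneq => <-; rewrite distxx.
have xz : x != z by apply/eqP=> xz; move: dxz; rewrite -xz distxx.
have xw i1 j1 : pair_ok (i1, j1) && faced pyramid_rows (i1, j1) -> x != w i1 j1.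
  move=> H; have [ePw _ _] := @w_P pyramid_rows rwsE (i1, j1) H.
  apply/eqP=> xw; move: ePw; rewrite [rest _ _ _](esym xw) e_sym -dist1.
  by case/andP: H => /dist_Q ->.
have xu k : (k < 5) && triangular pyramid_rows k -> x != u k.
  move=> H; have [ebu _ _] := @u_P pyramid_rows rwsE k H; apply/eqP=> xu.
  by move: ebu; rewrite -xu e_sym nonadj_xb //; case/andP: H.
have ne : all (fun k => x != nth x pyramid_vertices k) (iota 1 27).
  by rewrite /=; repeat match goal with |- is_true (_ && _) => apply/andP; split end;
  first [exact: isT | exact: xn | exact: P_nx | exact: xb | exact: xz | exact: xw | exact: xu].
case: i => // i i28 xi; have := allP ne i.+1; rewrite mem_iota xi eqxx.
by move=> /(_ i28).
Qed.

Lemma pyramid_nbrs i : i < 28 -> let s := [seq nth x pyramid_vertices j | j <- nth [::] pyramid_adj i] in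
  uniq s /\ forall y, e (nth x pyramid_vertices i) y = (y \in s).
Proof.
move=> i28 s; have /andP[us sE] := pyramid_local i28; split=> //; apply: nbr_five => //.
rewrite size_map; apply/eqP; move: i i28 {s us sE}.
have /allP H : all (fun i => size (nth [::] pyramid_adj i) == 5) (iota 0 28) by [].
by move=> i i28; apply: H; rewrite mem_iota.
Qed.

End Pyramid.

End Frame.

(** * From a failing diametral pair to the isomorphism *)

Section Classify.
Variables x z : T.
Hypothesis dxz : d x z = 4.

(** A vertex of Gamma_2(x) outside Gamma_2(z) gives a zero column, a midpoint of [x] and [z] a
    nonzero one. The permutation [s] found by the search is absorbed by renumbering the neighbours
    of [x]. *)
Lemma frame_classified : ~~ (sphere e 2 x \subset sphere e 2 z) ->
  exists ns bs, [/\ uniq ns, forall y, (y \in ns) = e x y, uniq bs, forall y, (y \in bs) = e z y &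
    [seq frame_row x ns y | y <- bs] = tetra_rows \/
    [seq frame_row x ns y | y <- bs] = pyramid_rows].
Proof.
case/subsetPn=> m1 + m1z; rewrite memE => /eqP dm1; rewrite memE in m1z.
pose ns := enum (N x); pose bs := enum (N z).
have ns_uniq : uniq ns := enum_uniq _.
have nsE y : (y \in ns) = e x y by rewrite mem_enum memE.
have bs_uniq : uniq bs := enum_uniq _.
have bsE y : (y \in bs) = e z y by rewrite mem_enum memE.
have ns5 := size_nbrs ns_uniq nsE; have bs5 := size_nbrs bs_uniq bsE.
have [_ S2E] := P_list ns_uniq nsE.
have S2_col m : d x m = 2 -> exists2 c, c < 10 &
    column [seq frame_row x ns y | y <- bs] c = #|N m :&: N z|.
  move=> dm; have := S2E m; rewrite memE dm => /esym/mapP[q qp mE].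
  have c10 : index q pairs5 < 10 by rewrite -[10]/(size pairs5) index_mem.
  by exists (index q pairs5) => //; rewrite (@column_row x z ns bs bs_uniq bsE) // nth_index // -mE.
have [s [bs' [ps pbs rws]]] : exists s bs', [/\ perm_eq s (iota 0 5), perm_eq bs' bs &
    let M := [seq relabel s (frame_row x ns y) | y <- bs'] in M = tetra_rows \/ M = pyramid_rows].
  apply: classify_faces => //.
  - by move=> y; rewrite bsE => ezy; apply: mem_rows => //; apply: (row_ok_row dxz ns_uniq nsE).
  - by move=> y y'; rewrite !bsE => ezy ezy' yy'; apply: (overlap_row_le dxz ns_uniq nsE).
  - move=> c c10; rewrite (@column_row x z ns bs bs_uniq bsE) //; apply: common_02.
    have := mem_nth (0, 0) (c10 : c < size pairs5); set q := nth _ _ _ => qp.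
    apply/eqP=> qz; have := S2E z; rewrite memE dxz => /esym/negP; apply.
    by apply/mapP; exists q.
  - have [m [dm dmz]] := diametral_mid_ex dxz; have [c c10 cE] := S2_col m dm.
    by exists c => //; rewrite cE (muE dmz) mu2.
  have [c c10 cE] := S2_col m1 dm1; exists c => //; rewrite cE cards_eq0.
  apply/eqP/setP=> y; rewrite !memE; apply/negP=> /andP[em1y ezy].
  case/negP: m1z; rewrite (dist_two ezy (_ : e y m1)) // 1?e_sym //.
  by apply/eqP=> zm1; move: dm1; rewrite -zm1 dxz.
have s5 : size s = 5 by rewrite (perm_size ps).
have s_uniq : uniq s by rewrite (perm_uniq ps) iota_uniq.
have s_lt i : i < 5 -> nth 0 s i < 5.
  by move=> i5; have := mem_nth 0 (_ : i < size s); rewrite (perm_mem ps) mem_iota s5; apply.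
exists [seq nth x ns i | i <- s], bs'.
have pns : perm_eq [seq nth x ns i | i <- s] ns.
  by apply/(perm_iotaP x); exists s; rewrite // ns5.
split; first by rewrite (perm_uniq pns).
- by move=> y; rewrite (perm_mem pns).
- by rewrite (perm_uniq pbs).
- by move=> y; rewrite (perm_mem pbs).
have rowE y : frame_row x [seq nth x ns i | i <- s] y = relabel s (frame_row x ns y).
  apply/eq_in_map => q qp.
  have /and3P[q1 q2 q12] : [&& q.1 < 5, q.2 < 5 & q.1 != q.2] by move: q qp; apply/allP.
  rewrite entry_row ?s_lt // ?nth_uniq ?s5 //.
  by rewrite !(nth_map 0) ?s5.
by rewrite (eq_map rowE).
Qed.

Lemma nontorus_iso : connected_graph e -> ~~ (sphere e 2 x \subset sphere e 2 z) ->
  isomorphic e (cart_prod K2 Delta41).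
Proof.
move=> conn /frame_classified[ns [bs [ns_uniq nsE bs_uniq bsE [rwsE|rwsE]]]].
  by case: (tetra_absurd dxz ns_uniq nsE bs_uniq bsE rwsE).
apply: (@pyramid_iso _ _ x (pyramid_vertices x z ns bs)) => //.
  exact: (pyramid_fibre dxz ns_uniq nsE bs_uniq bsE rwsE).
exact: (pyramid_nbrs dxz ns_uniq nsE bs_uniq bsE rwsE).
Qed.

End Classify.
End Sporadic.

Lemma diameter4_dichotomy x0 z0 : connected_graph e -> d x0 z0 = 4 ->
  isomorphic e (cart_prod K2 Delta41) \/
  (bipartite e /\
   forall x : T, exists D3 D3' : {set T},
     [/\ D3 :|: D3' = sphere e 3 x, D3 :&: D3' = set0,
         [/\ #|sphere e 1 x| = mu.*2.+1, #|sphere e 2 x| = mu.*2.+1.*2, #|D3| = mu.*2.+1,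
             #|D3'| = 2 & #|sphere e 4 x| = 1] &
         equitable_with e (thm_cells e x D3 D3') (thm_quot mu.*2.+1)]).
Proof.
move=> conn d0.
case: (boolP [forall x, forall z, (d x z == 4) ==> (sphere e 2 x \subset sphere e 2 z)]) => [tor|].
  right; apply: all_torus_conclusion d0 => // x z dxz.
  by move/forallP/(_ x)/forallP/(_ z): tor; rewrite dxz.
case/forallPn=> x /forallPn[z]; rewrite negb_imply => /andP[/eqP dxz ntor]; left.
have [mu3|mu_le2] := ltnP 2 mu; first by rewrite diametral_torus in ntor.
have mu2 : mu = 2 by lia.
exact: (nontorus_iso mu2 dxz).
Qed.

End AmplyRegular.

Theorem theorem3p6 (T : finType) (e : rel T) (v k lam mu : nat) :
  simple_graph e -> connected_graph e -> diameter_eq e 4 ->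
  amply_regular e v k lam mu ->
  odd k -> 5 <= k -> mu.*2 = k - 1 ->
  isomorphic e (cart_prod K2 Delta41) \/
  (bipartite e /\
   forall x : T, exists D3 D3' : {set T},
     [/\ D3 :|: D3' = sphere e 3 x, D3 :&: D3' = set0,
         [/\ #|sphere e 1 x| = k, #|sphere e 2 x| = k.*2, #|D3| = k,
             #|D3'| = 2 & #|sphere e 4 x| = 1] &
         equitable_with e (thm_cells e x D3 D3') (thm_quot k)]).
Proof.
move=> [e_sym e_irr] conn [diam4 [x0 [z0 z0S]]] [_ regE lamE muE] _ k5 mu2k.
have kE : k = mu.*2.+1 by lia.
have mu_gt1 : 1 < mu by lia.
subst k.
have d0 : dist diam4 x0 z0 = 4 by apply/eqP; rewrite -in_sphere.
have muE' x y : dist diam4 x y = 2 -> #|nbhd e x :&: nbhd e y| = mu.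
  by move=> dxy; apply: muE; rewrite (in_sphere diam4) dxy.
have lam0 := triangle_free e_sym e_irr mu_gt1 lamE muE' regE d0.
exact: (diameter4_dichotomy e_sym e_irr mu_gt1 lamE muE' regE lam0 conn d0).
Qed.
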